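(* For all $z,y\in\mathcal Z$, the Gâteaux derivative of $j_h$ at $z$ in the direction $y$ is given by $$\langle j_h'(z),y\rangle=\int_0^T\langle\beta_h(t),y(t)\rangle_\Gamma\,\mathrm dt+\alpha\int_0^T\langle\dot z(t),\dot y(t)\rangle_\Gamma\,\mathrm dt,$$ where $\beta_h=R_h(S_hz-\mathbf u_d)$.
   Context: Setting. $\Omega\subset\mathbb R^d$ is a bounded Lipschitz domain with boundary $\Gamma$, partitioned into two non-overlapping relatively open sets $\Gamma_D,\Gamma_N$ ($\Gamma_D=\emptyset$ is allowed), and $T>0$. $A:B$ is the Frobenius product of matrices and $\mathbb R^{d\times d}_{\mathrm{sym}}$ the symmetric matrices. The coefficients $\mathcal C\in L^\infty(\Omega;\mathbb R^{(d\times d)\times(d\times d)})$, $\mathcal E\in L^\infty(\Omega;\mathbb R^{(d\times d)\times d})$, $\boldsymbol\kappa\in L^\infty(\Omega;\mathbb R^{d\times d}_{\mathrm{sym}})$ satisfy, a.e. in $\Omega$ and with constants $c_0,k_0>0$: $\mathcal CA\in\mathbb R^{d\times d}_{\mathrm{sym}}$ and $(\mathcal CA):B=A:(\mathcal CB)$ for all $A,B\in\mathbb R^{d\times d}$; $(\mathcal CA):A\ge c_0A:A$ for $A\in\mathbb R^{d\times d}_{\mathrm{sym}}$; $\mathcal E\mathbf b\in\mathbb R^{d\times d}_{\mathrm{sym}}$ and $(\boldsymbol\kappa\mathbf b)\cdot\mathbf b\ge k_0|\mathbf b|^2$ for $\mathbf b\in\mathbb R^d$. $\mathcal E^\top$ is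 defined by $(\mathcal E^\top A)\cdot\mathbf b=A:(\mathcal E\mathbf b)$. The density $\rho\in L^\infty(\Omega)$ is strictly positive ($\rho\ge\rho_0>0$ a.e.). $\boldsymbol\varepsilon(\mathbf u)=\frac12(\nabla\mathbf u+\nabla\mathbf u^\top)$. Spaces. $(\cdot,\cdot)_\Omega$, $\|\cdot\|_\Omega$, $\|\cdot\|_\Gamma$ are $L^2$ inner product/norms on $\Omega$, $\Gamma$; $\|\cdot\|_\rho^2=(\rho\,\cdot,\cdot)_\Omega$; $\gamma$ is the trace operator to $\Gamma$; $\langle\cdot,\cdot\rangle_\Gamma$ is the $H^{-1/2}(\Gamma)\times H^{1/2}(\Gamma)$ duality, equal to the $L^2(\Gamma)$ product on $L^2(\Gamma)$ functions. $\mathbf H^1_D(\Omega)$ is the space of $\mathbf u\in H^1(\Omega)^d$ with zero trace on $\Gamma_D$ (all of $H^1(\Omega)^d$ if $\Gamma_D=\emptyset$). $G:H^1(\Omega)\to\mathbb R$ is linear, bounded, with $G1\ne0$; $H^1_G(\Omega)=\{\psi\in H^1(\Omega):G\psi=0\}$. $L^2_0(\Gamma)=\{z\in L^2(\Gamma):\int_\Gamma z=0\}$. $\mathcal Z=\{z\in H^1(0,T;L^2_0(\Gamma)):z(0)=0\}$ with norm $\left(\int_0^T\|\dot z(\tau)\|_\Gamma^2\,\mathrm d\tau\right)^{1/2}$. $\mathcal U=C^0([0,T];\mathbf H^1_D(\Omega))$. $\mathcal X=L^2(0,T;L^2(\Gamma))$. Semidiscretization. $\mathbf V_h\subset\mathbf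 H^1_D(\Omega)$ and $W_h\subset H^1(\Omega)$ are finite-dimensional subspaces, $W_h$ contains the constant functions, and $W_h^G=W_h\cap H^1_G(\Omega)$. Let $a((\mathbf u,\psi),(\mathbf w,\varphi))=(\mathcal C\boldsymbol\varepsilon(\mathbf u)+\mathcal E\nabla\psi,\boldsymbol\varepsilon(\mathbf w))_\Omega+(-\mathcal E^\top\boldsymbol\varepsilon(\mathbf u)+\boldsymbol\kappa\nabla\psi,\nabla\varphi)_\Omega$. $S_h$: for $z\in\mathcal Z$ let $(\mathbf u_h,\psi_h)\in C^2([0,T];\mathbf V_h)\times C^0([0,T];W_h^G)$ be the unique solution of $(\rho\ddot{\mathbf u}_h(t),\mathbf w)_\Omega+a((\mathbf u_h(t),\psi_h(t)),(\mathbf w,\varphi))=-\langle z(t),\gamma\varphi\rangle_\Gamma$ for all $(\mathbf w,\varphi)\in\mathbf V_h\times W_h^G$ and all $t\in[0,T]$, with $\mathbf u_h(0)=\dot{\mathbf u}_h(0)=\mathbf 0$; $S_hz=\mathbf u_h\in\mathcal U$. $R_h$: for $\mathbf f\in\mathcal U$ let $(\mathbf p_h,\xi_h)\in C^2([0,T];\mathbf V_h)\times C^0([0,T];W_h^G)$ be the unique solution of $(\rho\ddot{\mathbf p}_h(t),\mathbf w)_\Omega+a((\mathbf p_h(t),\xi_h(t)),(\mathbf w,\varphi))=(\rho\,\mathbf f(t),\mathbf w)_\Omega$ for all $(\mathbf w,\varphi)\in\mathbf V_h\times W_h^G$ and all $t\in[0,T]$, with $\mathbf p_h(T)=\dot{\mathbf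 p}_h(T)=\mathbf 0$; $R_h\mathbf f=\gamma\xi_h\in\mathcal X$. Functional. $\mathbf u_d\in\mathcal U$ is given with $\mathbf u_d(0)=\mathbf 0$, $\alpha>0$, and $j_h:\mathcal Z\to[0,\infty)$ is $$j_h(z)=\frac12\int_0^T\|S_hz(t)-\mathbf u_d(t)\|_\rho^2\,\mathrm dt+\frac\alpha2\int_0^T\|\dot z(t)\|_\Gamma^2\,\mathrm dt.$$ *)

(* Defs.v *)
From HB Require Import structures.
From mathcomp Require Import all_boot all_order all_algebra.
From mathcomp Require Import all_classical all_reals all_analysis.

Set Implicit Arguments.
Unset Strict Implicit.
Unset Printing Implicit Defensive.
Import Order.TTheory GRing.Theory Num.Theory.
Import numFieldNormedType.Exports.

Local Open Scope classical_set_scope.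
Local Open Scope ring_scope.

Section euclidean.
Variable R : realType.

Definition dotv n (u v : 'rV[R]_n) : R := \sum_i u 0 i * v 0 i.

(* The library norm of 'rV[R]_n is the sup norm, whence this definition. *)
Definition enorm n (u : 'rV[R]_n) : R := Num.sqrt (dotv u u).

Definition frob m n (A B : 'M[R]_(m, n)) : R := \sum_i \sum_j A i j * B i j.

Definition ediam n (A : set 'rV[R]_n) : \bar R :=
  ereal_sup [set (enorm (p.1 - p.2))%:E | p in A `*` A].

End euclidean.

Section cover_outer_measure.
Context (R : realType) (T : pointedType).
Variable w : set T -> \bar R.
Hypothesis w_ge0 : forall A, (0 <= w A)%E.

(* The empty set always has weight 0, so that countable covers include the
   finite ones. *)
Definition weight0 (A : set T) : \bar R := if `[< A = set0 >] then 0%E else w A.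

Definition cover_outer (X : set T) : \bar R :=
  ereal_inf [set (\sum_(k <oo) weight0 (A k))%E |
             A in [set A : (set T)^nat | X `<=` \bigcup_k A k]].

Let D := g_sigma_algebraType [set: set T].

Let weight00 : weight0 set0 = 0%E.
Proof. by rewrite /weight0; case: asboolP. Qed.

Let weight0_ge0 A : (0 <= weight0 A)%E.
Proof. by rewrite /weight0; case: asboolP. Qed.

Lemma cover_outerE X : cover_outer X = @mu_ext _ D R weight0 X.
Proof.
rewrite /cover_outer /mu_ext; congr ereal_inf; apply/seteqP; split => _ [A hA <-];
  exists A => //; last by case: hA.
by split => // i; exact: sub_sigma_algebra.
Qed.

Lemma cover_outer0 : cover_outer set0 = 0%E.
Proof. by rewrite cover_outerE; exact: mu_ext0. Qed.

Lemma cover_outer_ge0 X : (0 <= cover_outer X)%E.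
Proof. by rewrite cover_outerE; exact: mu_ext_ge0. Qed.

Lemma le_cover_outer : {homo cover_outer : A B / A `<=` B >-> (A <= B)%E}.
Proof. by move=> A B AB; rewrite !cover_outerE; exact: le_mu_ext. Qed.

Lemma cover_outer_sigma_subadditive : sigma_subadditive cover_outer.
Proof.
move=> F; rewrite cover_outerE (eq_eseriesr (fun i _ => cover_outerE (F i))).
exact: (@mu_ext_sigma_subadditive _ D R weight0 weight0_ge0 F).
Qed.

End cover_outer_measure.

Section restriction.
Context (R : realType) (T : Type).

Definition restr_outer (mu : {outer_measure set T -> \bar R}) (D : set T) :
  set T -> \bar R := fun A => mu (A `&` D).

Variables (mu : {outer_measure set T -> \bar R}) (D : set T).

Let r0 : restr_outer mu D set0 = 0%E.
Proof. by rewrite /restr_outer set0I outer_measure0. Qed.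

Let r_ge0 A : (0 <= restr_outer mu D A)%E.
Proof. exact: outer_measure_ge0. Qed.

Let le_r : {homo restr_outer mu D : A B / A `<=` B >-> (A <= B)%E}.
Proof. by move=> A B AB; apply: le_outer_measure; exact: setSI. Qed.

Let r_sub : sigma_subadditive (restr_outer mu D).
Proof.
move=> F; rewrite /restr_outer setI_bigcupl.
exact: outer_measure_sigma_subadditive.
Qed.

HB.instance Definition _ :=
  isOuterMeasure.Build R T (restr_outer mu D) r0 r_ge0 le_r r_sub.

End restriction.

Section lebesgue_rV.
Variables (R : realType) (n : nat).

Definition box (a b : 'rV[R]_n) : set 'rV[R]_n :=
  [set x | forall i, a 0 i <= x 0 i < b 0 i].

(* +oo for a set that is not a box *)
Definition box_volume (A : set 'rV[R]_n) : \bar R :=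
  ereal_inf [set (\prod_i (p.2 0 i - p.1 0 i))%:E |
    p in [set p : 'rV[R]_n * 'rV[R]_n |
           (forall i, p.1 0 i <= p.2 0 i) /\ A = box p.1 p.2]].

Lemma box_volume_ge0 A : (0 <= box_volume A)%E.
Proof.
apply: le_ereal_inf_tmp => _ [p [p12 _] <-].
by rewrite lee_fin; apply: prodr_ge0 => i _; rewrite subr_ge0.
Qed.

Definition lebesgue_outer : set 'rV[R]_n -> \bar R := cover_outer box_volume.

HB.instance Definition _ := isOuterMeasure.Build R 'rV[R]_n lebesgue_outer
  (cover_outer0 box_volume_ge0) (cover_outer_ge0 box_volume_ge0)
  (@le_cover_outer R _ box_volume)
  (cover_outer_sigma_subadditive box_volume_ge0).

Definition unit_ball_volume : R :=
  fine (lebesgue_outer [set x | enorm x <= 1]).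

Lemma unit_ball_volume_ge0 : 0 <= unit_ball_volume.
Proof. by apply: fine_ge0; exact: outer_measure_ge0. Qed.

End lebesgue_rV.

(* k-dimensional Hausdorff measure of R^n, normalised by the volume of the unit
   ball of R^k so that it is the usual k-dimensional surface measure. *)
Section hausdorff.
Variables (R : realType) (k n : nat).

Definition hausdorff_weight (delta : R) (A : set 'rV[R]_n) : \bar R :=
  if (ediam A <= delta%:E)%E
  then (unit_ball_volume R k * (fine (ediam A) / 2) ^+ k)%:E else +oo%E.

Definition hausdorff_delta delta := cover_outer (hausdorff_weight delta).

Definition hausdorff_outer (A : set 'rV[R]_n) : \bar R :=
  ereal_sup [set hausdorff_delta delta A | delta in [set delta | 0 < delta]].

Lemma ediam_ge0 (A : set 'rV[R]_n) : A !=set0 -> (0 <= ediam A)%E.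
Proof.
move=> [x Ax]; apply: (@le_trans _ _ (enorm (x - x))%:E).
  by rewrite lee_fin sqrtr_ge0.
by apply: ereal_sup_ubound; exists (x, x).
Qed.

Lemma fine_ediam_ge0 (A : set 'rV[R]_n) : 0 <= fine (ediam A).
Proof.
have [->|/set0P/ediam_ge0/fine_ge0//] := eqVneq A set0.
by rewrite /ediam setX0 image_set0 ereal_sup0.
Qed.

Lemma hausdorff_weight_ge0 delta A : (0 <= hausdorff_weight delta A)%E.
Proof.
rewrite /hausdorff_weight; case: ifP => // _; rewrite lee_fin.
by rewrite mulr_ge0 ?unit_ball_volume_ge0// exprn_ge0// divr_ge0// fine_ediam_ge0.
Qed.

Let w0 := hausdorff_weight_ge0.

Lemma hausdorff_outer0 : hausdorff_outer set0 = 0%E.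
Proof.
rewrite /hausdorff_outer (_ : image _ _ = [set 0%E]) ?ereal_sup1//.
apply/seteqP; split => [_ [d _ <-]|_ ->]; first by rewrite /= /hausdorff_delta cover_outer0.
by exists 1 => //=; rewrite /hausdorff_delta cover_outer0.
Qed.

Lemma hausdorff_outer_ge0 A : (0 <= hausdorff_outer A)%E.
Proof.
apply: (@le_trans _ _ (hausdorff_delta 1 A)); first exact: cover_outer_ge0.
by apply: ereal_sup_ubound; exists 1 => //=.
Qed.

Lemma le_hausdorff_outer : {homo hausdorff_outer : A B / A `<=` B >-> (A <= B)%E}.
Proof.
move=> A B AB; apply: ge_ereal_sup => _ [d d0 <-].
apply: (@le_trans _ _ (hausdorff_delta d B)); first exact: le_cover_outer.
by apply: ereal_sup_ubound; exists d.
Qed.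

Lemma hausdorff_outer_sigma_subadditive : sigma_subadditive hausdorff_outer.
Proof.
move=> F; apply: ge_ereal_sup => _ [d d0 <-].
apply: (le_trans (cover_outer_sigma_subadditive (@w0 d) F)).
apply: lee_nneseries => i _; first by move=> _; exact: cover_outer_ge0.
by apply: ereal_sup_ubound; exists d.
Qed.

HB.instance Definition _ := isOuterMeasure.Build R 'rV[R]_n hausdorff_outer
  hausdorff_outer0 hausdorff_outer_ge0 le_hausdorff_outer
  hausdorff_outer_sigma_subadditive.

End hausdorff.

(* Integrals, L^p spaces and null sets of an outer measure are those of the
   (complete) measure it induces on its Caratheodory sigma-algebra. *)
Section outer_integral.
Context (R : realType) (T : pointedType).
Variable mu : {outer_measure set T -> \bar R}.

Definition cara_measure : {measure set (caratheodory_type mu) -> \bar R} :=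
  (mu : set (caratheodory_type mu) -> \bar R).

Definition integ (f : T -> R) : R :=
  \int[cara_measure]_x (f : caratheodory_type mu -> R) x.

Definition Lp (p : \bar R) (f : T -> R) : Prop :=
  (f : caratheodory_type mu -> R) \in Lfun cara_measure p.

Definition ae (P : T -> Prop) : Prop :=
  {ae cara_measure, forall x : caratheodory_type mu, P x}.

Definition L2ip (f g : T -> R) : R := integ (fun x => f x * g x).

Definition L2norm (f : T -> R) : R := Num.sqrt (L2ip f f).

End outer_integral.

Section smooth.
Context (R : realType) (V : normedModType R).

(* k-fold continuous differentiability, through iterated directional
   derivatives *)
Fixpoint Cdiff (k : nat) (f : V -> R) : Prop :=
  continuous f /\
  if k is k'.+1 then
    forall v, (forall x, derivable f x v) /\ Cdiff k' (fun x => 'D_v f x)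
  else True.

Definition test_function (U : set V) (phi : V -> R) : Prop :=
  (forall k, Cdiff k phi) /\
  exists K, [/\ compact K, K `<=` U & forall x, ~ K x -> phi x = 0].

End smooth.

(* Functions of time with values in a space V of functions, on which N is a
   seminorm vanishing exactly on the functions that are zero a.e. *)
Section time_functions.
Context (R : realType) (V : lmodType R) (N : V -> R) (T : R).
Implicit Types (u : R -> V).

Definition time_continuous u : Prop := forall t, t \in `[0, T] ->
  N (u s - u t) @[s --> within `[0, T] (nbhs t)] --> (0 : R).

Definition time_derivative u u' : Prop := forall t, t \in `[0, T] ->
  N ((s - t)^-1 *: (u s - u t) - u' t)
    @[s --> within (`[0, T] `\ t) (nbhs t)] --> (0 : R).

(* C^2([0, T]; X) with its first two derivatives *)
Definition time_C2 (X : set V) u u' u'' : Prop :=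
  [/\ forall t, t \in `[0, T] -> [/\ X (u t), X (u' t) & X (u'' t)],
      time_derivative u u', time_derivative u' u'' & time_continuous u''].

Record step_fun := StepFun {
  sf_size : nat;
  sf_set : 'I_sf_size -> set R;
  sf_val : 'I_sf_size -> V }.

Definition is_step (X : set V) (s : step_fun) : Prop :=
  forall i, measurable (@sf_set s i) /\ X (@sf_val s i).

Definition sf_eval (s : step_fun) (t : R) : V :=
  \sum_i \1_(@sf_set s i) t *: @sf_val s i.

Definition sf_integral (s : step_fun) : V :=
  \sum_i fine (lebesgue_measure (@sf_set s i `&` `[0, T])) *: @sf_val s i.

Definition strongly_measurable (X : set V) u : Prop :=
  exists s : nat -> step_fun,
    (forall k, is_step X (s k)) /\
    forall t, t \in `[0, T] -> N (sf_eval (s k) t - u t) @[k --> \oo] --> (0 : R).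

Definition is_bochner_integral (X : set V) u (v : V) : Prop :=
  [/\ strongly_measurable X u, X v &
   exists s : nat -> step_fun,
     [/\ forall k, is_step X (s k),
         (\int[lebesgue_measure]_(t in `[0%R, T]) (N (sf_eval (s k) t - u t))%:E)%E
           @[k --> \oo] --> 0%E &
         N (sf_integral (s k) - v) @[k --> \oo] --> (0 : R)]].

(* L^2(0, T; X); every class has a representative which is the limit of simple
   functions everywhere on [0, T]. *)
Definition bochner_L2 (X : set V) u : Prop :=
  [/\ forall t, t \in `[0, T] -> X (u t), strongly_measurable X u &
      (\int[lebesgue_measure]_(t in `[0%R, T]) (N (u t) ^+ 2)%:E < +oo)%E].

Definition weak_time_derivative (X : set V) u u' : Prop :=
  forall phi : R -> R, test_function `]0, T[ phi ->
  exists v, is_bochner_integral X (fun t => 'D_1 phi t *: u t) v /\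
            is_bochner_integral X (fun t => phi t *: u' t) (- v).

End time_functions.

(* A Sobolev function is represented by the pair of the function and its weak
   gradient; for a vector field, the (i, j) entry of the second component is
   the j-th partial derivative of the i-th component. *)
Notation scalar_field R n :=
  (('rV[R]_n.+1 -> R) * ('rV[R]_n.+1 -> 'rV[R]_n.+1))%type.
Notation vector_field R n :=
  (('rV[R]_n.+1 -> 'rV[R]_n.+1) * ('rV[R]_n.+1 -> 'M[R]_n.+1))%type.

(* An element of the space Z is represented by the pair of its continuous
   representative on [0, T] and of its weak time derivative. *)
Notation control R n :=
  ((R -> 'rV[R]_n.+1 -> R) * (R -> 'rV[R]_n.+1 -> R))%type.

Section sobolev.
Context (R : realType) (n : nat).
Let d := n.+1.
Local Notation E := 'rV[R]_d.
Local Notation sfield := (scalar_field R n).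
Local Notation vfield := (vector_field R n).

Definition lipschitz_graph_fun (g : 'rV[R]_n -> R) : Prop :=
  exists L, forall x y, `|g x - g y| <= L * enorm (x - y).

(* the topological boundary of an open set *)
Definition bdry (Om : set E) : set E := closure Om `\` Om.

Definition lipschitz_domain (Om : set E) : Prop :=
  [/\ Om !=set0, open Om, connected Om, bounded_set Om &
   forall x0, bdry Om x0 ->
   exists (r : R) (Q : 'M[R]_d) (g : 'rV[R]_n -> R),
     [/\ 0 < r, Q *m Q^T = 1%:M, lipschitz_graph_fun g &
         forall x, enorm (x - x0) < r ->
           Om x <-> g (col' ord_max (x *m Q)) < (x *m Q) 0 ord_max]].

Definition relatively_open (Gam A : set E) : Prop :=
  exists U : set E, open U /\ A = Gam `&` U.

(* The interface between GamD and GamN is not covered by two disjoint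
   relatively open sets, hence the closures. *)
Definition boundary_partition (Gam GamD GamN : set E) : Prop :=
  [/\ relatively_open Gam GamD, relatively_open Gam GamN,
      GamD `&` GamN = set0 & closure GamD `|` closure GamN = Gam].

(* Lebesgue measure on Om and surface measure on the boundary of Om, extended
   by zero: functions on Om or on the boundary are represented by functions on
   R^d whose values elsewhere are irrelevant. *)
Definition vol (Om : set E) : {outer_measure set E -> \bar R} :=
  restr_outer (@lebesgue_outer R d) Om.

Definition surf (Om : set E) : {outer_measure set E -> \bar R} :=
  restr_outer (@hausdorff_outer R n d) (bdry Om).

Definition component (i : 'I_d) (u : vfield) : sfield :=
  (fun x => u.1 x 0 i, fun x => row i (u.2 x)).

Definition const_field (c : R) : sfield := (fun=> c, fun=> 0).

Section spaces.
Variable Om : set E.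

Definition H1 (v : sfield) : Prop :=
  [/\ Lp (vol Om) 2%:E v.1,
      forall i, Lp (vol Om) 2%:E (fun x => v.2 x 0 i) &
      forall phi, test_function Om phi -> forall i,
        L2ip (vol Om) v.1 (fun x => 'D_(delta_mx 0 i) phi x) =
        - L2ip (vol Om) (fun x => v.2 x 0 i) phi].

Definition H1norm (v : sfield) : R :=
  Num.sqrt (integ (vol Om) (fun x => v.1 x ^+ 2 + dotv (v.2 x) (v.2 x))).

Definition H1v (u : vfield) : Prop := forall i, H1 (component i u).

Definition H1vnorm (u : vfield) : R :=
  Num.sqrt (integ (vol Om) (fun x => dotv (u.1 x) (u.1 x) + frob (u.2 x) (u.2 x))).

Definition aeq (A B : Type) (u v : (E -> A) * (E -> B)) : Prop :=
  ae (vol Om) (fun x => u.1 x = v.1 x /\ u.2 x = v.2 x).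

(* X is a finite-dimensional subspace, as a set of classes modulo a.e. equality *)
Definition fin_dim_s (X : set sfield) : Prop :=
  exists (m : nat) (b : 'I_m -> sfield),
    forall u, X u <-> exists c : 'I_m -> R, aeq u (\sum_i c i *: b i).

Definition fin_dim_v (X : set vfield) : Prop :=
  exists (m : nat) (b : 'I_m -> vfield),
    forall u, X u <-> exists c : 'I_m -> R, aeq u (\sum_i c i *: b i).

Definition L2bdry : set (E -> R) := Lp (surf Om) 2%:E.

Definition L20bdry : set (E -> R) :=
  [set z | L2bdry z /\ integ (surf Om) z = 0].

(* gam is the trace operator H^1(Om) -> L^2(bdry Om): the bounded linear
   extension of the restriction of functions continuous up to the boundary *)
Definition is_trace (gam : sfield -> E -> R) : Prop :=
  [/\ forall v, H1 v -> L2bdry (gam v),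
      forall (a : R) v w, H1 v -> H1 w ->
        ae (surf Om) (fun x => gam (a *: v + w) x = a * gam v x + gam w x),
      exists c, forall v, H1 v -> L2norm (surf Om) (gam v) <= c * H1norm v &
      forall v, H1 v -> {within closure Om, continuous v.1} ->
        ae (surf Om) (fun x => gam v x = v.1 x)].

Definition is_bounded_functional (G : sfield -> R) : Prop :=
  (forall (a : R) v w, H1 v -> H1 w -> G (a *: v + w) = a * G v + G w) /\
  exists c, forall v, H1 v -> `|G v| <= c * H1norm v.

Definition H1G (G : sfield -> R) : set sfield := [set v | H1 v /\ G v = 0].

Definition H1D (gam : sfield -> E -> R) (GamD : set E) : set vfield :=
  [set u | H1v u /\
     forall i, ae (surf Om) (fun x => GamD x -> gam (component i u) x = 0)].

End spaces.

Section coefficients.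
Variables (Om : set E) (C : E -> 'I_d -> 'I_d -> 'I_d -> 'I_d -> R)
  (Ee : E -> 'I_d -> 'I_d -> 'I_d -> R) (kappa : E -> 'M[R]_d) (rho : E -> R).

Definition app_C (x : E) (A : 'M[R]_d) : 'M[R]_d :=
  \matrix_(i, j) \sum_k \sum_l C x i j k l * A k l.

Definition app_E (x : E) (b : 'rV[R]_d) : 'M[R]_d :=
  \matrix_(i, j) \sum_k Ee x i j k * b 0 k.

Definition app_ET (x : E) (A : 'M[R]_d) : 'rV[R]_d :=
  \row_k \sum_i \sum_j Ee x i j k * A i j.

Lemma app_ETE x A b : dotv (app_ET x A) b = frob A (app_E x b).
Proof.
rewrite /dotv /frob.
under eq_bigr do rewrite mxE big_distrl /=.
rewrite exchange_big; apply: eq_bigr => i _.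
under eq_bigr do rewrite big_distrl /=.
rewrite exchange_big; apply: eq_bigr => j _.
rewrite mxE big_distrr; apply: eq_bigr => k _ /=.
by rewrite mulrAC mulrC.
Qed.

(* kappa acts on column vectors; vectors are rows here. *)
Definition app_kappa (x : E) (b : 'rV[R]_d) : 'rV[R]_d := b *m (kappa x)^T.

Definition symmetric (A : 'M[R]_d) : Prop := A^T = A.

Definition admissible_C : Prop :=
  [/\ forall i j k l, Lp (vol Om) +oo%E (fun x => C x i j k l),
      ae (vol Om) (fun x => forall A, symmetric (app_C x A)),
      ae (vol Om) (fun x => forall A B,
        frob (app_C x A) B = frob A (app_C x B)) &
      exists2 c0 : R, 0 < c0 & ae (vol Om) (fun x => forall A, symmetric A ->
        c0 * frob A A <= frob (app_C x A) A)].

Definition admissible_E : Prop :=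
  (forall i j k, Lp (vol Om) +oo%E (fun x => Ee x i j k)) /\
  ae (vol Om) (fun x => forall b, symmetric (app_E x b)).

Definition admissible_kappa : Prop :=
  [/\ forall i j, Lp (vol Om) +oo%E (fun x => kappa x i j),
      ae (vol Om) (fun x => symmetric (kappa x)) &
      exists2 k0 : R, 0 < k0 & ae (vol Om) (fun x => forall b,
        k0 * enorm b ^+ 2 <= dotv (app_kappa x b) b)].

Definition admissible_rho : Prop :=
  Lp (vol Om) +oo%E rho /\
  exists2 rho0 : R, 0 < rho0 & ae (vol Om) (fun x => rho0 <= rho x).

Definition eps (u : vfield) (x : E) : 'M[R]_d := 2^-1 *: (u.2 x + (u.2 x)^T).

Definition aform (u : vfield) (psi : sfield) (w : vfield) (phi : sfield) : R :=
  integ (vol Om) (fun x =>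
    frob (app_C x (eps u x) + app_E x (psi.2 x)) (eps w x)) +
  integ (vol Om) (fun x =>
    dotv (- app_ET x (eps u x) + app_kappa x (psi.2 x)) (phi.2 x)).

Definition rho_ip (u w : vfield) : R :=
  integ (vol Om) (fun x => rho x * dotv (u.1 x) (w.1 x)).

Section semidiscrete.
Variables (gam : sfield -> E -> R) (T : R) (Vh : set vfield) (WhG : set sfield).

Definition zero_v (u : vfield) : Prop := aeq Om u 0.

Definition solves_state (z : R -> E -> R) (u : R -> vfield) (psi : R -> sfield) : Prop :=
  exists u' u'' : R -> vfield,
  [/\ time_C2 (H1vnorm Om) T Vh u u' u'',
      forall t, t \in `[0, T] -> WhG (psi t),
      time_continuous (H1norm Om) T psi,
      zero_v (u 0) /\ zero_v (u' 0) &
      forall w phi t, Vh w -> WhG phi -> t \in `[0, T] ->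
        rho_ip (u'' t) w + aform (u t) (psi t) w phi =
        - L2ip (surf Om) (z t) (gam phi)].

Definition solves_adjoint (f : R -> vfield) (p : R -> vfield) (xi : R -> sfield) : Prop :=
  exists p' p'' : R -> vfield,
  [/\ time_C2 (H1vnorm Om) T Vh p p' p'',
      forall t, t \in `[0, T] -> WhG (xi t),
      time_continuous (H1norm Om) T xi,
      zero_v (p T) /\ zero_v (p' T) &
      forall w phi t, Vh w -> WhG phi -> t \in `[0, T] ->
        rho_ip (p'' t) w + aform (p t) (xi t) w phi = rho_ip (f t) w].

End semidiscrete.
End coefficients.

Section control.
Variables (Om : set E) (gam : sfield -> E -> R) (GamD : set E) (T : R).

Definition Zspace : set (control R n) :=
  [set z | let N := L2norm (surf Om) in let X := L20bdry Om in
    [/\ bochner_L2 N T X z.1, bochner_L2 N T X z.2,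
        weak_time_derivative N T X z.1 z.2, time_continuous N T z.1 &
        ae (surf Om) (fun x => z.1 0 x = 0)]].

Definition Uspace : set (R -> vfield) :=
  [set u | (forall t, t \in `[0, T] -> H1D Om gam GamD (u t)) /\
           time_continuous (H1vnorm Om) T u].

Variables (C : E -> 'I_d -> 'I_d -> 'I_d -> 'I_d -> R)
  (Ee : E -> 'I_d -> 'I_d -> 'I_d -> R) (kappa : E -> 'M[R]_d) (rho : E -> R).
Variables (Vh : set vfield) (WhG : set sfield).

Definition is_state_operator (Sh : (R -> E -> R) -> R -> vfield) : Prop :=
  forall z : control R n, Zspace z ->
  exists psi, solves_state Om C Ee kappa rho gam T Vh WhG z.1 (Sh z.1) psi.

Definition is_adjoint_operator (Rh : (R -> vfield) -> R -> E -> R) : Prop :=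
  forall f, Uspace f -> exists p xi,
    solves_adjoint Om C Ee kappa rho T Vh WhG f p xi /\
    forall t, t \in `[0, T] -> Rh f t = gam (xi t).

Definition jh (Sh : (R -> E -> R) -> R -> vfield) (ud : R -> vfield) (alpha : R)
    (z : control R n) : R :=
  2^-1 * (\int[lebesgue_measure]_(t in `[0, T])
            rho_ip Om rho (Sh z.1 t - ud t) (Sh z.1 t - ud t)) +
  alpha / 2 * (\int[lebesgue_measure]_(t in `[0, T])
                 L2norm (surf Om) (z.2 t) ^+ 2).

Definition is_gateaux_derivative (j : control R n -> R) (z y : control R n)
    (l : R) : Prop :=
  (fun s : R => s^-1 * (j (z + s *: y) - j z)) @ (0 : R)^' --> l.

End control.
End sobolev.

(* Main.v *)
(* The derivative of [j_h] is computed from the duality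
     int rho_ip (f t) (S_h z t) dt = int L2ip (R_h f t) (z t) dt,
   which comes from testing the state equation for [(u, psi)] with [(p, - xi)]
   and the adjoint equation for [(p, xi)] with [(u, - psi)]: the stationary
   terms coincide, and [rho_ip p'' u - rho_ip u'' p] is the time derivative of
   [rho_ip p' u - rho_ip u' p], which vanishes at both ends.
   Put [e = S_h (z + s y) - S_h z] and [L g = int L2ip (R_h g t) (y t) dt].  The
   duality gives [int rho_ip g e = s L g] for all [g], whence also
   [int rho_ip e e = s L e = s int rho_ip e (S_h y) = s ^ 2 L (S_h y)], so that
   [S_h] need not be known to be linear.  Expanding the squares,
   [j_h (z + s y) - j_h z] is a quadratic polynomial in [s] whose linear
   coefficient is the claimed derivative. *)
Require Import Defs.
From mathcomp Require Import all_boot all_order all_algebra.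
From mathcomp Require Import all_classical all_reals all_analysis.
From mathcomp Require Import measurable_realfun ess_sup_inf ring lra.

Set Implicit Arguments.
Unset Strict Implicit.
Unset Printing Implicit Defensive.
Import Order.TTheory GRing.Theory Num.Theory.
Import numFieldNormedType.Exports.

Local Open Scope classical_set_scope.
Local Open Scope ring_scope.

(** * Semi-inner products *)

(** Fields are functions rather than classes modulo a.e. equality, and integrals are additive only
    on integrable functions. So no inner product space is formed: everything is stated for a set [X]
    closed under linear combinations and a form [Q] that is bilinear and nonnegative on [X] alone.
    Two instances serve: [L2field] with [H1v_ip] for the states, and [L20bdry] with the surface
    product [L2ip] for the controls. The overview takes for granted that [z + s y] is again a
    control, that differences of states are admissible data for [R_h], and that the time integrals
    of the expanded squares may be split. Most of the work lies there. Linearity of the weak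
    gradient requires test functions to be measurable for the Caratheodory sigma-algebra; linearity
    of the mean-zero condition requires a finite surface measure. Finiteness of volume and of
    surface both come from the constant field 1, which lies in [W_h], hence in [H1], and whose trace
    is 1. *)

Section semi_inner_product.
Context (R : realType) (V : lmodType R).
Implicit Types (X : set V) (B Q : V -> V -> R) (u v w : V).

Definition lin_closed X : Prop :=
  X 0 /\ forall a u v, X u -> X v -> X (a *: u + v).

(** Linearity is asked in the first argument and on [X] only; the second argument follows by
    symmetry. *)
Definition sym_bilinear X B : Prop :=
  (forall u v, X u -> X v -> B u v = B v u) /\
  forall a u v w, X u -> X v -> X w -> B (a *: u + v) w = a * B u w + B v w.

Definition semi_inner X Q : Prop :=
  sym_bilinear X Q /\ forall u, X u -> 0 <= Q u u.

Lemma lin_closedD X u v : lin_closed X -> X u -> X v -> X (u + v).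
Proof. by move=> [_ XL] Xu Xv; rewrite -[u]scale1r; exact: XL. Qed.

Lemma lin_closedZ X a u : lin_closed X -> X u -> X (a *: u).
Proof. by move=> [X0 XL] Xu; rewrite -[a *: u]addr0; exact: XL. Qed.

Lemma lin_closedN X u : lin_closed X -> X u -> X (- u).
Proof. by move=> hX Xu; rewrite -scaleN1r; exact: lin_closedZ. Qed.

Lemma lin_closedB X u v : lin_closed X -> X u -> X v -> X (u - v).
Proof. by move=> hX Xu Xv; apply: lin_closedD => //; exact: lin_closedN. Qed.

Lemma lin_closed_sum X (I : Type) (r : seq I) (f : I -> V) : lin_closed X ->
  (forall i, X (f i)) -> X (\sum_(i <- r) f i).
Proof.
move=> hX Xf; elim/big_ind: _ => //; first by case: hX.
by move=> *; exact: lin_closedD.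
Qed.

Section bilinear.
Variables (X : set V) (B : V -> V -> R).
Hypotheses (hX : lin_closed X) (hB : sym_bilinear X B).

Lemma bilDl u v w : X u -> X v -> X w -> B (u + v) w = B u w + B v w.
Proof. by move=> *; rewrite -[u in LHS]scale1r hB.2// mul1r. Qed.

Lemma bil0l w : X w -> B 0 w = 0.
Proof.
move=> Xw; have X0 := hX.1.
by have := bilDl X0 X0 Xw; rewrite addr0 => /eqP; rewrite -subr_eq subrr => /eqP <-.
Qed.

Lemma bilZl a u w : X u -> X w -> B (a *: u) w = a * B u w.
Proof.
by move=> Xu Xw; rewrite -[a *: u]addr0 hB.2 ?bil0l ?addr0//; case: hX.
Qed.

Lemma bilBl u v w : X u -> X v -> X w -> B (u - v) w = B u w - B v w.
Proof.
move=> Xu Xv Xw; rewrite addrC -scaleN1r hB.2// mulN1r addrC//.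
Qed.

Lemma bilDr u v w : X u -> X v -> X w -> B w (u + v) = B w u + B w v.
Proof.
move=> Xu Xv Xw; rewrite hB.1 ?bilDl ?(hB.1 w)//; exact: lin_closedD.
Qed.

Lemma bilZr a u w : X u -> X w -> B w (a *: u) = a * B w u.
Proof. by move=> Xu Xw; rewrite hB.1 ?bilZl ?(hB.1 w)//; exact: lin_closedZ. Qed.

Lemma bilBr u v w : X u -> X v -> X w -> B w (u - v) = B w u - B w v.
Proof.
move=> Xu Xv Xw; rewrite hB.1 ?bilBl ?(hB.1 w)//; exact: lin_closedB.
Qed.

Lemma bil_lin_sqr a u v : X u -> X v ->
  B (a *: u + v) (a *: u + v) = a ^+ 2 * B u u + 2 * a * B u v + B v v.
Proof.
move=> Xu Xv; have Xau := lin_closedZ a hX Xu.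
have Xs := lin_closedD hX Xau Xv.
by rewrite bilDl// !bilDr// !bilZl// !bilZr// (hB.1 v u)//; ring.
Qed.

Lemma bil_sum_sqr m (c : 'I_m -> R) (b : 'I_m -> V) : (forall i, X (b i)) ->
  B (\sum_i c i *: b i) (\sum_i c i *: b i) =
  \sum_i \sum_j c i * c j * B (b i) (b j).
Proof.
move=> Xb.
have Xs (r : seq 'I_m) : X (\sum_(i <- r) c i *: b i).
  by apply: lin_closed_sum => // i; exact: lin_closedZ.
have Bl w (r : seq 'I_m) : X w ->
    B (\sum_(i <- r) c i *: b i) w = \sum_(i <- r) c i * B (b i) w.
  move=> Xw; elim: r => [|i r IH]; first by rewrite !big_nil bil0l.
  by rewrite !big_cons hB.2// IH.
rewrite Bl//; apply: eq_bigr => i _.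
rewrite hB.1// Bl// mulr_sumr; apply: eq_bigr => j _.
by rewrite (hB.1 (b j))// mulrA.
Qed.

End bilinear.

Lemma semi_inner_CS X Q u v : lin_closed X -> semi_inner X Q -> X u -> X v ->
  Q u v ^+ 2 <= Q u u * Q v v.
Proof.
move=> hX hQ Xu Xv.
have key a : 0 <= a ^+ 2 * Q u u + 2 * a * Q u v + Q v v.
  by rewrite -(bil_lin_sqr hX hQ.1)// hQ.2//; apply: hX.2.
have [Q0|Qn0] := eqVneq (Q u u) 0.
  have [->|Qn0] := eqVneq (Q u v) 0; first by rewrite Q0 mul0r expr0n.
  (* With [Q u u = 0] the polynomial in [a] is affine of slope [2 * Q u v]; at this point it would
     take the value -1. *)
  have := key (- (Q v v + 1) / (2 * Q u v)).
  rewrite Q0 mulr0 add0r.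
  have -> : 2 * (- (Q v v + 1) / (2 * Q u v)) * Q u v + Q v v = -1 by field.
  by lra.
have Q0 : 0 < Q u u by rewrite lt_neqAle eq_sym Qn0 hQ.2.
(* The minimiser of the quadratic polynomial. *)
have := key (- Q u v / Q u u).
have -> : (- Q u v / Q u u) ^+ 2 * Q u u + 2 * (- Q u v / Q u u) * Q u v + Q v v
   = (Q u u * Q v v - Q u v ^+ 2) / Q u u by field.
by rewrite pmulr_lge0 ?invr_gt0// subr_ge0.
Qed.

Section seminorm.
Variables (X : set V) (Q : V -> V -> R).
Hypotheses (hX : lin_closed X) (hQ : semi_inner X Q).

Definition qnorm u : R := Num.sqrt (Q u u).

Lemma qnorm_ge0 u : 0 <= qnorm u. Proof. exact: sqrtr_ge0. Qed.

Lemma qnorm_sqr u : X u -> qnorm u ^+ 2 = Q u u.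
Proof. by move=> Xu; rewrite sqr_sqrtr// hQ.2. Qed.

Lemma qnorm_CS u v : X u -> X v -> `|Q u v| <= qnorm u * qnorm v.
Proof.
move=> Xu Xv; rewrite -sqrtrM ?hQ.2// -sqrtr_sqr ler_wsqrtr//.
exact: (semi_inner_CS hX hQ Xu Xv).
Qed.

Lemma qnormD u v : X u -> X v -> qnorm (u + v) <= qnorm u + qnorm v.
Proof.
move=> Xu Xv; rewrite -(@ler_pXn2r _ 2)// ?nnegrE ?addr_ge0 ?qnorm_ge0//.
rewrite qnorm_sqr; last exact: lin_closedD.
rewrite -{1 2}[u]scale1r (bil_lin_sqr hX hQ.1)// sqrrD !qnorm_sqr//.
have := le_trans (ler_norm _) (qnorm_CS Xu Xv); rewrite -mulr_natl; lra.
Qed.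

Lemma qnormZ a u : X u -> qnorm (a *: u) = `|a| * qnorm u.
Proof.
move=> Xu; rewrite /qnorm (bilZl hX hQ.1)//; last exact: lin_closedZ.
by rewrite (bilZr hX hQ.1)// mulrA -expr2 sqrtrM ?sqr_ge0// sqrtr_sqr.
Qed.

Lemma qnorm0 : qnorm 0 = 0.
Proof. by rewrite /qnorm (bil0l hX hQ.1) ?sqrtr0//; exact: hX.1. Qed.

Lemma qnormN u : X u -> qnorm (- u) = qnorm u.
Proof. by move=> Xu; rewrite -scaleN1r qnormZ// normrN1 mul1r. Qed.

Lemma qnormB u v : X u -> X v -> qnorm (u - v) <= qnorm u + qnorm v.
Proof.
move=> Xu Xv; rewrite -(qnormN Xv); apply: qnormD => //; exact: lin_closedN.
Qed.

(* Cauchy-Schwarz for the positive semidefinite form M Q + B. *)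
Lemma sym_bilinear_bounded B M : sym_bilinear X B -> 0 <= M ->
  (forall u, X u -> `|B u u| <= M * Q u u) ->
  forall u v, X u -> X v -> `|B u v| <= 3 * M * (qnorm u * qnorm v).
Proof.
move=> hB M0 BM u v Xu Xv.
pose P u v := M * Q u v + B u v.
have hP : semi_inner X P.
  split; last by move=> w Xw; have := BM _ Xw; rewrite ler_norml /P; lra.
  split; first by move=> a b Xa Xb; rewrite /P hQ.1.1// hB.1.
  by move=> a b c d Xb Xc Xd; rewrite /P hQ.1.2// hB.2//; ring.
have P2 w : X w -> P w w <= 2 * M * Q w w.
  by move=> Xw; have := BM _ Xw; rewrite ler_norml /P; lra.
have Puv : `|P u v| <= 2 * M * (qnorm u * qnorm v).
  have MQ w : X w -> 0 <= 2 * M * Q w w by move=> Xw; rewrite !mulr_ge0// hQ.2.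
  rewrite -(@ler_pXn2r _ 2)// ?nnegrE ?mulr_ge0 ?qnorm_ge0//.
  rewrite real_normK ?num_real// !exprMn !qnorm_sqr//.
  have -> : 2 ^+ 2 * M ^+ 2 * (Q u u * Q v v) = (2 * M * Q u u) * (2 * M * Q v v).
    by ring.
  apply: (le_trans (semi_inner_CS hX hP Xu Xv)).
  by apply: ler_pM; rewrite ?P2// hP.2.
(* The constant 3 is 2 from the bound on [P] plus 1 from Cauchy-Schwarz for [Q]. *)
have -> : B u v = P u v - M * Q u v by rewrite /P; ring.
rewrite (le_trans (ler_normB _ _))// normrM (ger0_norm M0).
have := ler_wpM2l M0 (qnorm_CS Xu Xv); lra.
Qed.

End seminorm.
End semi_inner_product.

(** * Functions of time *)

Section cvg_to_0.
Context (R : realType) (I : Type) (F : set_system I) (FF : Filter F).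
Implicit Types f g : I -> R.

Lemma cvg0_le f g : (\forall s \near F, 0 <= f s <= g s) ->
  g s @[s --> F] --> 0 -> f s @[s --> F] --> 0.
Proof. by move=> fg g0; apply: (squeeze_cvgr fg) => //; exact: cvg_cst. Qed.

Lemma cvg0D f g : f s @[s --> F] --> 0 -> g s @[s --> F] --> 0 ->
  f s + g s @[s --> F] --> 0.
Proof. by move=> f0 g0; rewrite -[X in _ --> X](addr0 0); exact: cvgD. Qed.

Lemma cvg0Ml a f : f s @[s --> F] --> 0 -> a * f s @[s --> F] --> 0.
Proof. by move=> f0; rewrite -[X in _ --> X](mulr0 a); exact: cvgMl_tmp. Qed.

Lemma cvg0Mr a f : f s @[s --> F] --> 0 -> f s * a @[s --> F] --> 0.
Proof. by move=> f0; rewrite -[X in _ --> X](mul0r a); exact: cvgMr_tmp. Qed.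

End cvg_to_0.

Section time_bilinear.
Context (R : realType) (V : lmodType R) (X : set V) (Q : V -> V -> R) (T : R).
Hypotheses (hX : lin_closed X) (hQ : semi_inner X Q).
Implicit Types (u v : R -> V).

Let N := qnorm Q.

Definition time_in u : Prop := forall t, t \in `[0, T] -> X (u t).

Lemma time_in_lin a u v : time_in u -> time_in v -> time_in (a *: u + v).
Proof. by move=> uX vX t tT; apply: hX.2; [exact: uX | exact: vX]. Qed.

Lemma time_continuous_lin a u v : time_in u -> time_in v ->
  time_continuous N T u -> time_continuous N T v ->
  time_continuous N T (a *: u + v).
Proof.
move=> uX vX cu cv t tT.
apply: (@cvg0_le _ _ _ _ _ (fun s => `|a| * N (u s - u t) + N (v s - v t)));
  last first.
  by apply: cvg0D; [apply: cvg0Ml; exact: cu | exact: cv].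
rewrite near_withinE; near=> s => sT; rewrite qnorm_ge0/=.
have Xu := lin_closedB hX (uX _ sT) (uX _ tT).
have Xv := lin_closedB hX (vX _ sT) (vX _ tT).
rewrite -(qnormZ hX hQ a Xu); apply: le_trans (qnormD hX hQ _ Xv); last first.
  exact: lin_closedZ.
rewrite [leLHS](_ : _ = qnorm Q (a *: (u s - u t) + (v s - v t)))// !fctE/=.
by rewrite opprD addrACA -scalerBr.
Unshelve. all: by end_near. Qed.

(** Near [t] the difference quotient is within seminorm 1 of [u' t], whence [N (u s - u t) <= |s -
    t| * (1 + N (u' t))]. *)
Lemma time_derivative_continuous u u' : time_in u -> time_in u' ->
  time_derivative N T u u' -> time_continuous N T u.
Proof.
move=> uX u'X du t tT; apply/cvgr0Pnorm_lt => e e0.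
have M0 : 0 < 1 + N (u' t) by rewrite ltr_pwDl// qnorm_ge0.
have /cvgr0Pnorm_lt /(_ _ ltr01) := du t tT.
rewrite !near_withinE => h; near=> s => sT.
have [->|st] := eqVneq s t; first by rewrite subrr [N _](qnorm0 hX hQ) normr0.
have st0 : s - t != 0 by rewrite subr_eq0.
have : (`[0, T] `\ t) s -> `|N ((s - t)^-1 *: (u s - u t) - u' t)| < 1.
  by near: s.
move=> /(_ (conj sT _))/=; move=> /(_ (elimN eqP st)).
rewrite !ger0_norm ?qnorm_ge0// => h1.
have Xu := lin_closedB hX (uX _ sT) (uX _ tT).
have Xq := lin_closedZ (s - t)^-1 hX Xu.
have -> : u s - u t = (s - t) *: (((s - t)^-1 *: (u s - u t) - u' t) + u' t).
  by rewrite subrK scalerA mulfV ?scale1r.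
rewrite [N _](qnormZ hX hQ); last by rewrite subrK.
apply: (@le_lt_trans _ _ (`|s - t| * (1 + N (u' t)))).
  have Xu' := u'X _ tT.
  rewrite ler_wpM2l//; apply: (le_trans (qnormD hX hQ (lin_closedB hX Xq Xu') Xu')).
  by rewrite lerD2r ltW.
rewrite -ltr_pdivlMr// distrC; near: s.
by apply: (@cvgr_dist_lt _ _ _ _ _ idfun) => //; rewrite divr_gt0.
Unshelve. all: by end_near. Qed.

Section bounded_form.
Variables (B : V -> V -> R) (K : R).
Hypotheses (hB : sym_bilinear X B)
  (BK : forall a b : V, X a -> X b -> `|B a b| <= K * (N a * N b)).

Lemma time_continuous_form u v : time_in u -> time_in v ->
  time_continuous N T u -> time_continuous N T v ->
  {within `[0, T], continuous (fun t => B (u t) (v t))}.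
Proof.
move=> uX vX cu cv; apply/subspace_continuousP => t tT.
apply/subr_cvg0; apply/norm_cvg0P.
apply: (@cvg0_le _ _ _ _ _ (fun s => K * (N (u s - u t) * N (v s - v t) +
  (N (u s - u t) * N (v t) + N (u t) * N (v s - v t))))); last first.
  apply: cvg0Ml; apply: cvg0D; last apply: cvg0D.
  - by rewrite -[X in _ --> X](mulr0 0); apply: cvgM; [exact: cu|exact: cv].
  - by apply: cvg0Mr; exact: cu.
  - by apply: cvg0Ml; exact: cv.
rewrite near_withinE; near=> s => sT; rewrite normr_ge0/=.
have [Xus Xut Xvs Xvt] := And4 (uX _ sT) (uX _ tT) (vX _ sT) (vX _ tT).
have [Xu Xv] := (lin_closedB hX Xus Xut, lin_closedB hX Xvs Xvt).
(* Both arguments are expanded about [t]; every term carries at least one increment. *)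
have -> : B (u s) (v s) - B (u t) (v t) =
    B (u s - u t) (v s - v t) + (B (u s - u t) (v t) + B (u t) (v s - v t)).
  by rewrite !(bilBl hB)// !(bilBr hX hB)//; ring.
rewrite !mulrDr (le_trans (ler_normD _ _))// lerD ?BK//.
by rewrite (le_trans (ler_normD _ _))// lerD ?BK.
Unshelve. all: by end_near. Qed.

Lemma is_derive_form u u' v v' t : time_in u -> time_in u' ->
  time_in v -> time_in v' -> time_derivative N T u u' ->
  time_derivative N T v v' -> t \in `]0, T[ ->
  is_derive t 1 (fun s => B (u s) (v s)) (B (u' t) (v t) + B (u t) (v' t)).
Proof.
move=> uX u'X vX v'X du dv t0T.
have tT : t \in `[0, T] by exact: subset_itv_oo_cc t0T.
have cv := time_derivative_continuous vX v'X dv.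
have lim0 : `|(s - t)^-1 * (B (u s) (v s) - B (u t) (v t)) -
    (B (u' t) (v t) + B (u t) (v' t))|
    @[s --> within (`[0, T] `\ t) (nbhs t)] --> 0.
  pose q (w : R -> V) s := (s - t)^-1 *: (w s - w t).
  have cv' : N (v s - v t) @[s --> within (`[0, T] `\ t) (nbhs t)] --> 0.
    apply/cvgr0Pnorm_lt => e e0; move/cvgr0Pnorm_lt : (cv t tT) => /(_ _ e0).
    by rewrite !near_withinE; apply: filterS => s sT [/sT].
  apply: (@cvg0_le _ _ _ _ _ (fun s => K * (N (q u s - u' t) * N (v s - v t) +
    (N (q u s - u' t) * N (v t) + (N (u' t) * N (v s - v t) +
     N (u t) * N (q v s - v' t)))))); last first.
    apply: cvg0Ml; apply: cvg0D; last apply: cvg0D; last apply: cvg0D.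
    - rewrite -[X in _ --> X](mulr0 0); apply: cvgM; [exact: du|exact: cv'].
    - by apply: cvg0Mr; exact: du.
    - by apply: cvg0Ml; exact: cv'.
    - by apply: cvg0Ml; exact: dv.
  rewrite near_withinE; near=> s => -[sT /eqP st]; rewrite normr_ge0/=.
  have st0 : s - t != 0 by rewrite subr_eq0.
  have [Xus Xut Xvs Xvt] := And4 (uX _ sT) (uX _ tT) (vX _ sT) (vX _ tT).
  have [Xu't Xv't] := (u'X _ tT, v'X _ tT).
  have [Xu Xv] := (lin_closedB hX Xus Xut, lin_closedB hX Xvs Xvt).
  have Xqu : X (q u s) by exact: lin_closedZ.
  have Xqv : X (q v s) by exact: lin_closedZ.
  have Xqu' := lin_closedB hX Xqu Xu't.
  have Xqv' := lin_closedB hX Xqv Xv't.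
  (* Leibniz rule with remainder: every term has a factor tending to 0, either the error of a
     difference quotient or the increment of [v]. *)
  have -> : (s - t)^-1 * (B (u s) (v s) - B (u t) (v t)) -
      (B (u' t) (v t) + B (u t) (v' t)) =
      B (q u s - u' t) (v s - v t) + (B (q u s - u' t) (v t) +
      (B (u' t) (v s - v t) + B (u t) (q v s - v' t))).
    rewrite !(bilBl hB)// !(bilBr hX hB)//.
    rewrite !(bilZl hX hB)// !(bilZr hX hB)// !(bilBl hB)// !(bilBr hX hB)//.
    by ring.
  rewrite !mulrDr (le_trans (ler_normD _ _))// lerD ?BK//.
  rewrite (le_trans (ler_normD _ _))// lerD ?BK//.
  by rewrite (le_trans (ler_normD _ _))// lerD ?BK.
(* As [t] is interior, a whole neighbourhood of it lies in [[0, T]], so the limit relative to the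
   interval is the two-sided one that [is_derive] asks for. *)
have lim : h^-1 *: (B (u (h *: 1 + t)) (v (h *: 1 + t)) - B (u t) (v t))
    @[h --> 0^'] --> B (u' t) (v t) + B (u t) (v' t).
  apply/cvgrPdistC_lt => e e0.
  move/cvgr0Pnorm_lt : lim0 => /(_ _ e0); rewrite near_withinE => near_t.
  have {}near_t : \forall s \near t, s != t ->
      `|(s - t)^-1 * (B (u s) (v s) - B (u t) (v t)) -
        (B (u' t) (v t) + B (u t) (v' t))| < e.
    near=> s => st; rewrite -[ltLHS]normr_id.
    have sT : s \in `[0, T].
      by apply: subset_itv_oo_cc; near: s; exact: near_in_itvoo.
    suff : (`[0, T] `\ t) s by near: s.
    by split => //=; exact/eqP.
  move: near_t; rewrite (near_shift 0 t) subr0 => near_0.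
  rewrite /dnbhs near_withinE; near=> h => h0.
  have -> : h *: 1 + t = h + t by rewrite /GRing.scale/= mulr1.
  have /= := near near_0 h _.
  rewrite addrK; apply => //.
  by rewrite -subr_eq0 addrK.
by apply: DeriveDef; [apply/cvg_ex; eexists; exact: lim | exact: cvg_lim lim].
Unshelve. all: by end_near. Qed.

(** In the derivative of [B u' v - B v' u] the two products of first derivatives cancel by symmetry.
    The derivative is taken in the open interval, and continuity up to the ends lets the fundamental
    theorem of calculus apply. Values lie in [Y] (here [V_h]), while differences and quotients are
    formed in the larger [X]. *)
Lemma integral_wronskian u u' u'' v v' v'' (Y : set V) : 0 < T -> Y `<=` X ->
  time_C2 N T Y u u' u'' -> time_C2 N T Y v v' v'' ->
  {within `[0, T], continuous (fun t => B (u'' t) (v t) - B (v'' t) (u t))} /\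
  \int[lebesgue_measure]_(t in `[0, T]) (B (u'' t) (v t) - B (v'' t) (u t)) =
  (B (u' T) (v T) - B (v' T) (u T)) - (B (u' 0) (v 0) - B (v' 0) (u 0)).
Proof.
move=> T0 YX [uY du du' cu''] [vY dv dv' cv''].
have [uX u'X u''X] : [/\ time_in u, time_in u' & time_in u''].
  by split => t tT; apply: YX; have [] := uY t tT.
have [vX v'X v''X] : [/\ time_in v, time_in v' & time_in v''].
  by split => t tT; apply: YX; have [] := vY t tT.
have cu := time_derivative_continuous uX u'X du.
have cu' := time_derivative_continuous u'X u''X du'.
have cv := time_derivative_continuous vX v'X dv.
have cv' := time_derivative_continuous v'X v''X dv'.
pose g t := B (u' t) (v t) - B (v' t) (u t).
pose g' t := B (u'' t) (v t) - B (v'' t) (u t).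
have cB2 (a b c d : R -> V) : time_in a -> time_in b -> time_in c -> time_in d ->
    time_continuous N T a -> time_continuous N T b -> time_continuous N T c ->
    time_continuous N T d ->
    {within `[0, T], continuous (fun t => B (a t) (b t) - B (c t) (d t))}.
  move=> aX bX cX dX ca cb cc cd t.
  by apply: (@cvgB _ R^o); exact: time_continuous_form.
have cg' : {within `[0, T], continuous g'} by exact: cB2.
split=> //.
have cg : {within `[0, T], continuous g} by exact: cB2.
have dg t : t \in `]0, T[ -> is_derive t 1 g (g' t).
  move=> tT; have tT' := subset_itv_oo_cc tT.
  have := is_deriveB (is_derive_form u'X u''X vX v'X du' dv tT)
                     (is_derive_form v'X v''X uX u'X dv' du tT).
  congr is_derive; rewrite /g' (hB.1 (v' t) (u' t)); first ring.
    exact: v'X.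
  exact: u'X.
have [_ g0 gT] := (continuous_within_itvP g T0).1 cg.
rewrite /Rintegral (@continuous_FTC2 _ g' g)//; first last.
- by move=> t tT; rewrite derive1E; apply: (@derive_val _ _ _ _ _ _ _ (dg t tT)).
- split=> // t tT; exact: (@ex_derive _ _ _ _ _ _ _ (dg t tT)).
Qed.

End bounded_form.
End time_bilinear.

(** * Step functions and Bochner integrals *)

Section step_functions.
Context (R : realType) (V : lmodType R).
Implicit Types s : step_fun V.

(** The two families are juxtaposed: the sets of a step function may overlap, so no common
    refinement is formed. *)
Definition step_lin (a : R) s1 s2 : step_fun V :=
  @StepFun _ _ (sf_size s1 + sf_size s2)
    (fun i => match fintype.split i with inl j => sf_set j | inr j => sf_set j end)
    (fun i => match fintype.split i with
              | inl j => a *: sf_val j | inr j => sf_val j end).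

Let split_lshift m n (i : 'I_m) : fintype.split (lshift n i) = inl i.
Proof. exact: (unsplitK (inl i)). Qed.

Let split_rshift m n (i : 'I_n) : fintype.split (rshift m i) = inr i.
Proof. exact: (unsplitK (inr i)). Qed.

Lemma sf_eval_lin a s1 s2 t :
  sf_eval (step_lin a s1 s2) t = a *: sf_eval s1 t + sf_eval s2 t.
Proof.
rewrite /sf_eval big_split_ord scaler_sumr; congr (_ + _); apply: eq_bigr => i _.
  by rewrite /= split_lshift !scalerA mulrC.
by rewrite /= split_rshift.
Qed.

Lemma sf_integral_lin T a s1 s2 :
  sf_integral T (step_lin a s1 s2) = a *: sf_integral T s1 + sf_integral T s2.
Proof.
rewrite /sf_integral big_split_ord scaler_sumr; congr (_ + _).
  by apply: eq_bigr => i _; rewrite /= split_lshift !scalerA mulrC.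
by apply: eq_bigr => i _; rewrite /= split_rshift.
Qed.

Lemma is_step_lin (X : set V) a s1 s2 : lin_closed X ->
  is_step X s1 -> is_step X s2 -> is_step X (step_lin a s1 s2).
Proof.
move=> hX h1 h2 i /=; case: (fintype.split i) => j; last exact: h2.
by split; [exact: (h1 j).1 | apply: lin_closedZ => //; exact: (h1 j).2].
Qed.

Lemma is_step_eval (X : set V) s t : lin_closed X -> is_step X s -> X (sf_eval s t).
Proof.
move=> hX hs; apply: lin_closed_sum => // i.
by apply: lin_closedZ => //; exact: (hs i).2.
Qed.

Lemma is_step_integral (X : set V) s T : lin_closed X -> is_step X s ->
  X (sf_integral T s).
Proof.
move=> hX hs; apply: lin_closed_sum => // i.
by apply: lin_closedZ => //; exact: (hs i).2.
Qed.

End step_functions.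

Section bochner.
Context (R : realType) (V : lmodType R) (X : set V) (Q : V -> V -> R) (T : R).
Hypotheses (hX : lin_closed X) (hQ : semi_inner X Q).
Implicit Types (u v : R -> V).

Let N := qnorm Q.
Let J : set R := `[0, T].

Lemma qnorm_linB a (x y x' y' : V) : X x -> X y -> X x' -> X y' ->
  N ((a *: x + y) - (a *: x' + y')) <= `|a| * N (x - x') + N (y - y').
Proof.
move=> Xx Xy Xx' Xy'.
have [X1 X2] := (lin_closedB hX Xx Xx', lin_closedB hX Xy Xy').
rewrite -(qnormZ hX hQ a X1) opprD addrACA -scalerBr.
by apply: (qnormD hX hQ _ X2); exact: lin_closedZ.
Qed.

Lemma strongly_measurable_lin a u v : time_in X T u -> time_in X T v ->
  strongly_measurable N T X u -> strongly_measurable N T X v ->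
  strongly_measurable N T X (a *: u + v).
Proof.
move=> uX vX [s [sX su]] [r [rX rv]]; exists (fun k => step_lin a (s k) (r k)).
split=> [k|t tT]; first exact: is_step_lin.
apply: (@cvg0_le _ _ _ _ _
  (fun k => `|a| * N (sf_eval (s k) t - u t) + N (sf_eval (r k) t - v t))).
  apply: nearW => k; rewrite qnorm_ge0/= sf_eval_lin.
  apply: qnorm_linB; [exact: is_step_eval|exact: is_step_eval|exact: uX|exact: vX].
by apply: cvg0D; [apply: cvg0Ml; exact: su | exact: rv].
Qed.

Lemma strongly_measurable_step (s : step_fun V) : is_step X s ->
  strongly_measurable N T X (sf_eval s).
Proof.
move=> sX; exists (fun=> s); split=> // t tT.
by under eq_fun do rewrite subrr [N _](qnorm0 hX hQ); exact: cvg_cst.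
Qed.

(** For a step function, [N] is the square root of a quadratic polynomial in indicator functions,
    hence measurable. The reverse triangle inequality carries this over to pointwise limits in
    [N]. *)
Lemma measurable_qnorm u : time_in X T u -> strongly_measurable N T X u ->
  measurable_fun J (N \o u).
Proof.
move=> uX [s [sX su]].
apply: (@measurable_fun_cvg _ _ _ _ (fun k t => N (sf_eval (s k) t))) => [k|t tT].
- rewrite [X in measurable_fun _ X](_ : _ = Num.sqrt \o fun t => \sum_i \sum_j
      (\1_(@sf_set _ _ (s k) i) t * \1_(@sf_set _ _ (s k) j) t) *
      Q (@sf_val _ _ (s k) i) (@sf_val _ _ (s k) j)).
    apply: measurableT_comp.
      by apply: continuous_measurable_fun; exact: sqrt_continuous.
    apply: measurable_sum => i; apply: measurable_sum => j.
    apply: measurable_funM; last exact: measurable_cst.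
    by apply: measurable_funM; apply: measurable_indic; exact: (sX k _).1.
  apply/funext => t; rewrite /N /qnorm (bil_sum_sqr hX hQ.1)// => i.
  exact: (sX k i).2.
- apply/subr_cvg0; apply/norm_cvg0P.
  apply: cvg0_le (su t tT); apply: nearW => k; rewrite normr_ge0/=.
  have [Xs Xu] := (is_step_eval t hX (sX k), uX t tT).
  have Xd := lin_closedB hX Xs Xu.
  rewrite ler_norml; apply/andP; split.
    have := qnormB hX hQ Xs Xd.
    by rewrite opprB addrC subrK -/N; lra.
  by have := qnormD hX hQ Xd Xu; rewrite subrK -/N; lra.
Qed.

Lemma is_bochner_integral_lin a u v (x y : V) : time_in X T u -> time_in X T v ->
  is_bochner_integral N T X u x -> is_bochner_integral N T X v y ->
  is_bochner_integral N T X (a *: u + v) (a *: x + y).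
Proof.
move=> uX vX [mu Xx [s [sX su sx]]] [mv Xy [r [rX rv ry]]].
split; [exact: strongly_measurable_lin | exact: hX.2|].
exists (fun k => step_lin a (s k) (r k)); split=> [k||]; first exact: is_step_lin.
(* Splitting the integral of the majorant requires measurable integrands. These are norms of
   strongly measurable functions, a step function being strongly measurable itself. *)
- have mN (w : R -> V) (p : step_fun V) : time_in X T w -> is_step X p ->
      strongly_measurable N T X w ->
      measurable_fun J (fun t => N (sf_eval p t - w t)).
    move=> wX pX mw.
    rewrite [X in measurable_fun _ X](_ : _ = N \o (-1 *: w + sf_eval p));
      last first.
      by apply/funext => t; rewrite /= !fctE scaleN1r addrC.
    have pX' : time_in X T (sf_eval p) by move=> t _; exact: is_step_eval.
    apply: measurable_qnorm; first exact: time_in_lin.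
    by apply: strongly_measurable_lin => //; exact: strongly_measurable_step.
  pose Js k := (\int[lebesgue_measure]_(t in J) (N (sf_eval (s k) t - u t))%:E)%E.
  pose Jr k := (\int[lebesgue_measure]_(t in J) (N (sf_eval (r k) t - v t))%:E)%E.
  have le k : (0 <= \int[lebesgue_measure]_(t in J)
        (N (sf_eval (step_lin a (s k) (r k)) t - (a *: u + v) t))%:E <=
        `|a|%:E * Js k + Jr k)%E.
    apply/andP; split.
      by apply: integral_ge0 => t _; rewrite lee_fin qnorm_ge0.
    have mI : measurable J by exact: measurable_itv.
    have ms := mN _ _ uX (sX k) mu; have mr := mN _ _ vX (rX k) mv.
    rewrite /Js /Jr -ge0_integralZl_EFin//; last 2 first.
    + by move=> t _; rewrite lee_fin qnorm_ge0.
    + exact/measurable_EFinP.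
    rewrite -ge0_integralD//; last 4 first.
    + by move=> t _; rewrite mule_ge0// lee_fin ?qnorm_ge0.
    + by apply/measurable_EFinP; exact: measurable_funM.
    + by move=> t _; rewrite lee_fin qnorm_ge0.
    + exact/measurable_EFinP.
    apply: ge0_le_integral => //.
    + by move=> t _; rewrite lee_fin qnorm_ge0.
    + apply/measurable_EFinP; apply: mN => //; last exact: strongly_measurable_lin.
        exact: time_in_lin.
      exact: is_step_lin.
    + apply/measurable_EFinP; apply: measurable_funD => //.
      exact: measurable_funM.
    + move=> t tT; rewrite -EFinM -EFinD lee_fin sf_eval_lin.
      by apply: qnorm_linB;
        [exact: is_step_eval|exact: is_step_eval|exact: uX|exact: vX].
  apply: (@squeeze_cvge _ _ _ _ (cst 0%E) _ (fun k => `|a|%:E * Js k + Jr k)%E).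
  + exact: nearW.
  + exact: cvg_cst.
  + rewrite -[X in _ --> X](adde0 0%E) -[X in _ --> (X + _)%E](mule0 `|a|%:E).
    apply: cvgeD; [by rewrite mule0 | by apply: cvgeZl | exact: rv].
- apply: (@cvg0_le _ _ _ _ _ (fun k => `|a| * N (sf_integral T (s k) - x) +
    N (sf_integral T (r k) - y))).
    apply: nearW => k; rewrite qnorm_ge0/= sf_integral_lin.
    by apply: qnorm_linB => //; exact: is_step_integral.
  by apply: cvg0D => //; exact: cvg0Ml.
Qed.

Lemma bochner_L2_integrable u : bochner_L2 N T X u ->
  lebesgue_measure.-integrable J (EFin \o (fun t => Q (u t) (u t))).
Proof.
move=> [uX mu fu].
have mN := measurable_qnorm uX mu.
have mI : measurable J by exact: measurable_itv.
have iN : lebesgue_measure.-integrable J (EFin \o (fun t => N (u t) ^+ 2)).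
  apply/integrableP; split.
    by apply/measurable_EFinP; exact: measurable_funX.
  by under eq_integral do rewrite /= ger0_norm ?sqr_ge0//.
apply: (eq_integrable _ _ _ _ iN) => //.
by move=> t; rewrite inE => tT /=; rewrite [N _ ^+ 2](qnorm_sqr hQ)//; exact: uX.
Qed.

Lemma bochner_L2_lin a u v : bochner_L2 N T X u -> bochner_L2 N T X v ->
  bochner_L2 N T X (a *: u + v).
Proof.
move=> hu hv; have [[uX mu fu] [vX mv fv]] := (hu, hv).
have wX := time_in_lin hX a uX vX.
have mw := strongly_measurable_lin a uX vX mu mv.
split=> //.
have mN := measurable_qnorm wX mw.
have mI : measurable J by exact: measurable_itv.
have iM : lebesgue_measure.-integrable J
    (EFin \o (fun t => 2 * a ^+ 2 * Q (u t) (u t) + 2 * Q (v t) (v t))).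
  have h1 := integrableZl _ (2 * a ^+ 2) (bochner_L2_integrable hu).
  have h2 := integrableZl _ 2 (bochner_L2_integrable hv).
  have := integrableD _ (h1 _) (h2 _).
  move=> /(_ (measurable_itv _) (measurable_itv _) (measurable_itv _)).
  apply: eq_integrable => // t _ /=; rewrite EFinD !EFinM.
have /integrableP[mM iMoo] := iM.
apply: le_lt_trans iMoo.
apply: ge0_le_integral => //.
- by move=> t _; rewrite lee_fin sqr_ge0.
- by apply/measurable_EFinP; exact: measurable_funX.
- exact: measurableT_comp.
- move=> t tT; rewrite /= lee_fin.
  have [Xu Xv] := (uX t tT, vX t tT).
  have Qu := hQ.2 _ Xu; have Qv := hQ.2 _ Xv.
  rewrite [N _ ^+ 2](qnorm_sqr hQ); last exact: wX.
  rewrite (le_trans _ (ler_norm _))// (_ : (a *: u + v) t = a *: u t + v t)//.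
  rewrite (bil_lin_sqr hX hQ.1)//.
  (* The value of [Q] at [- a *: u t + v t] is exactly the gap between the majorant
     [2 a^2 Q u u + 2 Q v v] and the square of [a *: u + v]. *)
  have Xm := hX.2 (- a) _ _ Xu Xv.
  have := hQ.2 _ Xm; rewrite (bil_lin_sqr hX hQ.1)// sqrrN; lra.
Qed.

(** Polarisation: strong measurability yields measurable squares, so the mixed product is a quarter
    of the difference of the squares of [u + v] and [v - u]. *)
Lemma bochner_L2_form_integrable u v : bochner_L2 N T X u -> bochner_L2 N T X v ->
  lebesgue_measure.-integrable J (EFin \o (fun t => Q (u t) (v t))).
Proof.
move=> hu hv; have [[uX mu fu] [vX mv fv]] := (hu, hv).
have mI : measurable J by exact: measurable_itv.
have h1 := bochner_L2_integrable (bochner_L2_lin 1 hu hv).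
have h2 := bochner_L2_integrable (bochner_L2_lin (-1) hu hv).
have h1' := integrableZl _ 4^-1 h1; have h2' := integrableZl _ (- 4^-1) h2.
have := integrableD _ (h1' _) (h2' _).
move=> /(_ (measurable_itv _) (measurable_itv _) (measurable_itv _)).
  apply: eq_integrable => // t /set_mem tT /=.
have [Xu Xv] := (uX t tT, vX t tT).
rewrite -!EFinM -EFinD; congr EFin.
rewrite (_ : (1 *: u + v) t = 1 *: u t + v t)//.
rewrite (_ : (-1 *: u + v) t = -1 *: u t + v t)// !(bil_lin_sqr hX hQ.1)//.
by field.
Qed.

Lemma weak_time_derivative_lin a u v u' v' :
  time_in X T u -> time_in X T v -> time_in X T u' -> time_in X T v' ->
  weak_time_derivative N T X u u' -> weak_time_derivative N T X v v' ->
  weak_time_derivative N T X (a *: u + v) (a *: u' + v').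
Proof.
move=> uX vX u'X v'X hu hv phi hphi.
have [x [ux u'x]] := hu _ hphi; have [y [vy v'y]] := hv _ hphi.
have hZ (f : R -> R) w : time_in X T w -> time_in X T (fun t => f t *: w t).
  by move=> wX t tT; apply: lin_closedZ => //; exact: wX.
have scE (f : R -> R) w w' : (fun t => f t *: (a *: w + w') t) =
    a *: (fun t => f t *: w t) + (fun t => f t *: w' t).
  by apply/funext => t; rewrite !fctE /= scalerDr !scalerA mulrC.
exists (a *: x + y); rewrite !scE; split.
  by apply: is_bochner_integral_lin => //; exact: hZ.
rewrite opprD -scalerN.
by apply: is_bochner_integral_lin => //; exact: hZ.
Qed.

End bochner.

(** * Square integrable functions *)

Section outer_Lp.
Context (R : realType) (T : pointedType).
Variable mu : {outer_measure set T -> \bar R}.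
Implicit Types f g h c : T -> R.

#[global] Instance ae_outer_filter : Filter (ae mu).
Proof. exact: (ae_filter_ringOfSetsType (cara_measure mu)). Qed.

Definition L1 f : Prop := (cara_measure mu).-integrable setT
  (EFin \o (f : caratheodory_type mu -> R)).

Lemma L1_lin a f g : L1 f -> L1 g -> L1 (fun x => a * f x + g x).
Proof.
move=> hf hg; have h := integrableZl measurableT a hf.
by have := integrableD measurableT h hg; apply: eq_integrable.
Qed.

Lemma L1_0 : L1 (fun=> 0).
Proof. exact: integrable0. Qed.

Lemma L1D f g : L1 f -> L1 g -> L1 (fun x => f x + g x).
Proof. by move=> hf hg; have := L1_lin 1 hf hg; under eq_fun do rewrite mul1r. Qed.

Lemma L1Z a f : L1 f -> L1 (fun x => a * f x).
Proof.
by move=> hf; have := L1_lin a hf L1_0; under eq_fun do rewrite addr0.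
Qed.

Lemma L1_sum (I : Type) (r : seq I) (F : I -> T -> R) :
  (forall i, L1 (F i)) -> L1 (fun x => \sum_(i <- r) F i x).
Proof.
move=> hF; elim: r => [|i r IH].
  by under eq_fun do rewrite big_nil; exact: L1_0.
by under eq_fun do rewrite big_cons; exact: L1D.
Qed.

Lemma integ_lin a f g : L1 f -> L1 g ->
  integ mu (fun x => a * f x + g x) = a * integ mu f + integ mu g.
Proof.
move=> hf hg; rewrite /integ RintegralD//; last exact: (L1Z a hf).
by rewrite RintegralZl.
Qed.

Lemma integD f g : L1 f -> L1 g ->
  integ mu (fun x => f x + g x) = integ mu f + integ mu g.
Proof. by move=> hf hg; rewrite /integ RintegralD. Qed.

Lemma eq_integ f g : (forall x, f x = g x) -> integ mu f = integ mu g.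
Proof. by move=> fg; congr integ; exact/funext. Qed.

Lemma integ_ge0 f : (forall x, 0 <= f x) -> 0 <= integ mu f.
Proof. by move=> f0; apply: Rintegral_ge0. Qed.

Lemma ae_eq_integ f g : L1 f -> L1 g -> ae mu (fun x => f x = g x) ->
  integ mu f = integ mu g.
Proof.
move=> hf hg fg; rewrite /integ /Rintegral; congr fine.
apply: ae_eq_integral => //.
- by case/integrableP : hf.
- by case/integrableP : hg.
- by apply: filterS fg => x /= -> _.
Qed.

Lemma Lp2_lin a f g : Lp mu 2%:E f -> Lp mu 2%:E g ->
  Lp mu 2%:E (fun x => a * f x + g x).
Proof.
move=> hf hg; rewrite /Lp (_ : (fun x => _) =
  a *: (f : caratheodory_type mu -> R) + (g : caratheodory_type mu -> R))//.
have [p0 pL] := @Lfun_submod_closed _ _ _ (cara_measure mu) 2%:E (lee1n 2).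
exact: pL.
Qed.

Lemma Lp2_0 : Lp mu 2%:E (fun=> 0).
Proof. by have [] := @Lfun_submod_closed _ _ _ (cara_measure mu) 2%:E (lee1n 2). Qed.

Lemma L2_mul f g : Lp mu 2%:E f -> Lp mu 2%:E g -> L1 (fun x => f x * g x).
Proof. by move=> hf hg; apply/Lfun1_integrable/Lfun2_mul_Lfun1. Qed.

Lemma L2_ae f g : Lp mu 2%:E f -> Lp mu 2%:E g -> ae mu (fun x => f x = g x) ->
  forall h, Lp mu 2%:E h -> L2ip mu f h = L2ip mu g h.
Proof.
move=> hf hg fg h hh; apply: ae_eq_integ; [exact: L2_mul|exact: L2_mul|].
by apply: filterS fg => x /= ->.
Qed.

Definition ess_bounded c M : Prop :=
  measurable_fun setT (c : caratheodory_type mu -> R) /\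
  ae mu (fun x => `|c x| <= M).

Lemma Lp_oo_bounded c : Lp mu +oo%E c -> exists2 M, 0 <= M & ess_bounded c M.
Proof.
rewrite /Lp inE => /andP[]; rewrite !inE /= => mc.
rewrite /finite_norm unlock /Lnorm; case: ifPn => [mu0|mu0 _].
- move=> hc; pose e := ess_sup (cara_measure mu) (abse \o (EFin \o c)).
  have e0 : (0 <= e)%E.
    by apply: ess_sup_gee => //; apply: nearW => x; rewrite /= lee_fin.
  have efin : e \is a fin_num by rewrite ge0_fin_numE.
  exists (fine e); first exact: fine_ge0.
  split=> //; have := ess_sup_ge (cara_measure mu) (abse \o (EFin \o c)).
  by apply: filterS => x /=; rewrite -lee_fin fineK.
(* The whole space is null: the essential supremum is not consulted, and everything serves as the
   exceptional set. *)
- exists 0 => //; split => //; exists setT; split => //.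
  by apply/eqP; rewrite eq_le measure_ge0 andbT leNgt.
Qed.

Lemma ess_bounded_mul c M f : ess_bounded c M -> L1 f -> L1 (fun x => c x * f x).
Proof.
move=> [mc cM] hf; have [mf foo] := integrableP _ _ _ hf.
have {}mf : measurable_fun setT (f : caratheodory_type mu -> R).
  exact/measurable_EFinP.
apply/integrableP; split; first by apply/measurable_EFinP; exact: measurable_funM.
have /integrableP[mMf Mfoo] := L1Z M hf.
apply: le_lt_trans Mfoo; apply: ae_ge0_le_integral => //.
- by apply/measurable_EFinP; apply: measurableT_comp => //; exact: measurable_funM.
- exact: measurableT_comp.
- apply: filterS cM => x /= cM _; rewrite lee_fin !normrM ler_wpM2r//.
  exact: le_trans (ler_norm _).
Qed.

Lemma ess_bounded_integ c M f : ess_bounded c M -> L1 f -> (forall x, 0 <= f x) ->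
  `|integ mu (fun x => c x * f x)| <= M * integ mu f.
Proof.
move=> hc hf f0; have hcf := ess_bounded_mul hc hf.
have hMf := L1Z M hf.
have [mcf cfoo] := integrableP _ _ _ hcf.
have [mMf Mfoo] := integrableP _ _ _ hMf.
apply: (le_trans (le_normr_Rintegral _ hcf)) => //.
rewrite /integ -RintegralZl//.
have le : (\int[cara_measure mu]_x `|(c x * f x)%:E| <=
           \int[cara_measure mu]_x `|(M * f x)%:E|)%E.
  apply: ae_ge0_le_integral => //; try exact: measurableT_comp.
  apply: filterS hc.2 => x /= cM _; rewrite lee_fin !normrM ler_wpM2r//.
  exact: le_trans (ler_norm _).
(* The sign of [M] is not among the hypotheses; it is read off [0 <= |c x| <= M] at almost every
   point. *)
have Mf0 : ae mu (fun x => 0 <= M * f x).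
  apply: filterS hc.2 => x cM; rewrite mulr_ge0//; exact: le_trans cM.
have -> : \int[cara_measure mu]_x (M * f x) = \int[cara_measure mu]_x `|M * f x|.
  apply: ae_eq_integ => //.
    by have := integrable_norm hMf.
  by apply: filterS Mf0 => x /= /ger0_norm ->.
rewrite fine_le//.
- rewrite ge0_fin_numE//; exact: integral_ge0.
- rewrite ge0_fin_numE//; exact: integral_ge0.
Qed.

Lemma Lp2_lin_closed : lin_closed (Lp mu 2%:E : set (T -> R)).
Proof. by split; [exact: Lp2_0 | move=> *; exact: Lp2_lin]. Qed.

Lemma L2ip_semi_inner : semi_inner (Lp mu 2%:E : set (T -> R)) (L2ip mu).
Proof.
split; first split.
- by move=> f g _ _; apply: eq_integ => x; rewrite mulrC.
- move=> a f g h hf hg hh; rewrite /L2ip -integ_lin; [|exact: L2_mul|exact: L2_mul].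
  by apply: eq_integ => x; rewrite (_ : (a *: f + g) x = a * f x + g x)//; ring.
- by move=> f _; apply: integ_ge0 => x; rewrite -expr2 sqr_ge0.
Qed.

End outer_Lp.

Section Lp2_more.
Context (R : realType) (T : pointedType).
Variable mu : {outer_measure set T -> \bar R}.
Implicit Types f g c : T -> R.

Lemma Lp2_measurable f : Lp mu 2%:E f ->
  measurable_fun setT (f : caratheodory_type mu -> R).
Proof. by rewrite /Lp inE => /andP[]; rewrite inE. Qed.

Lemma measurable_sqr_Lp2 f : measurable_fun setT (f : caratheodory_type mu -> R) ->
  L1 mu (fun x => f x ^+ 2) -> Lp mu 2%:E f.
Proof.
move=> mf /integrableP[_ foo]; rewrite /Lp inE; apply/andP; split; rewrite inE//=.
rewrite /finite_norm unlock /Lnorm; apply: poweR_lty.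
apply: le_lt_trans foo; rewrite le_eqVlt; apply/orP; left; apply/eqP.
apply: eq_integral => x _ /=.
by rewrite powR_mulrn// normrX.
Qed.

Lemma ae_eq_Lp2 f g : measurable_fun setT (f : caratheodory_type mu -> R) ->
  Lp mu 2%:E g -> ae mu (fun x => g x = f x) -> Lp mu 2%:E f.
Proof.
move=> mf hg gf; apply: measurable_sqr_Lp2 => //.
have /integrableP[mg goo] := L2_mul hg hg.
apply/integrableP; split; first by apply/measurable_EFinP; exact: measurable_funX.
apply: le_lt_trans goo; rewrite le_eqVlt; apply/orP; left; apply/eqP.
apply: ae_eq_integral => //.
- apply: measurableT_comp => //; apply/measurable_EFinP; exact: measurable_funX.
- exact: measurableT_comp.
- by apply: filterS gf => x /= -> _; rewrite expr2.
Qed.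

Lemma Lp_oo_mul_Lp2 c f : Lp mu +oo%E c -> Lp mu 2%:E f ->
  Lp mu 2%:E (fun x => c x * f x).
Proof.
move=> /Lp_oo_bounded[M _ hc] hf; apply: measurable_sqr_Lp2.
  by apply: measurable_funM; [exact: hc.1 | exact: Lp2_measurable].
under eq_fun do rewrite exprMn expr2 -mulrA.
by do 2 apply: (ess_bounded_mul hc); under eq_fun do rewrite expr2; exact: L2_mul.
Qed.

Lemma Lp2_sum (I : Type) (r : seq I) (F : I -> T -> R) :
  (forall i, Lp mu 2%:E (F i)) -> Lp mu 2%:E (fun x => \sum_(i <- r) F i x).
Proof.
move=> hF; elim: r => [|i r IH].
  by under eq_fun do rewrite big_nil; exact: Lp2_0.
under eq_fun do rewrite big_cons -[F i _]mul1r; exact: Lp2_lin.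
Qed.

Lemma Lp2Z a f : Lp mu 2%:E f -> Lp mu 2%:E (fun x => a * f x).
Proof.
by move=> hf; have := Lp2_lin a hf (Lp2_0 mu); under eq_fun do rewrite addr0.
Qed.

Lemma Lp2D f g : Lp mu 2%:E f -> Lp mu 2%:E g -> Lp mu 2%:E (fun x => f x + g x).
Proof. by move=> hf hg; have := Lp2_lin 1 hf hg; under eq_fun do rewrite mul1r. Qed.

Lemma Lp2N f : Lp mu 2%:E f -> Lp mu 2%:E (fun x => - f x).
Proof. by move=> hf; have := Lp2Z (-1) hf; under eq_fun do rewrite mulN1r. Qed.

End Lp2_more.

(** * Lebesgue measure on R^n *)

Section borel_caratheodory.
Context (R : realType) (n : nat).
Local Notation E := 'rV[R]_n.+1.
Implicit Types (A X : set E) (i : 'I_n.+1) (c : R).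

Definition halfspace i c : set E := [set x | x 0 i < c].

(** A hyperplane orthogonal to an axis cuts a box into two boxes whose volumes add up. Other sets
    have volume [+oo], an infimum over the empty set, so only boxes have to be treated. *)
Lemma box_volume_halfspace A i c :
  (box_volume (A `&` halfspace i c) + box_volume (A `&` ~` halfspace i c) <=
   box_volume A)%E.
Proof.
apply: le_ereal_inf_tmp => _ [[a b] [/= ab ->] <-].
(* [c] clamped to the [i]-th side of the box: if the hyperplane misses the box, one of the pieces
   degenerates but its corners stay ordered. *)
pose m := Num.max (a 0 i) (Num.min (b 0 i) c).
have [am mb] : a 0 i <= m /\ m <= b 0 i.
  by rewrite /m le_max lexx ge_max ab ge_min lexx.
pose b' : E := \row_j (if j == i then m else b 0 j).
pose a' : E := \row_j (if j == i then m else a 0 j).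
have boxl : box a b `&` halfspace i c = box a b'.
  apply/seteqP; split=> x.
    move=> [xab xc] j; rewrite mxE; case: eqP => [->|_]; last exact: xab.
    have /andP[ax xb] := xab i.
    by rewrite ax /m lt_max lt_min xb -/(halfspace i c x) xc orbT.
  move=> xb'; split=> [j|].
    have := xb' j; rewrite mxE; case: eqP => [->|_//] /andP[-> xm].
    exact: lt_le_trans mb.
  have := xb' i; rewrite mxE eqxx => /andP[ax].
  by rewrite /m lt_max ltNge ax/= lt_min => /andP[].
have boxr : box a b `&` ~` halfspace i c = box a' b.
  apply/seteqP; split=> x.
    move=> [xab /negP]; rewrite -leNgt => cx j.
    rewrite mxE; case: eqP => [->|_]; last exact: xab.
    have /andP[ax xb] := xab i.
    by rewrite xb andbT /m ge_max ax ge_min cx orbT.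
  move=> xa'; split=> [j|].
    have := xa' j; rewrite mxE; case: eqP => [->|_//] /andP[mx ->].
    by rewrite (le_trans am).
  have := xa' i; rewrite mxE eqxx => /andP[mx xb].
  apply/negP; rewrite -leNgt; move: mx; rewrite /m ge_max => /andP[_].
  by rewrite ge_min leNgt xb.
have ab' j : a 0 j <= b' 0 j by rewrite mxE; case: eqP => [->|].
have a'b j : a' 0 j <= b 0 j by rewrite mxE; case: eqP => [->|].
rewrite boxl boxr.
apply: (@le_trans _ _
  ((\prod_j (b' 0 j - a 0 j))%:E + (\prod_j (b 0 j - a' 0 j))%:E)%E).
  by apply: leeD; apply: ereal_inf_lbound; [exists (a, b') | exists (a', b)].
rewrite -EFinD lee_fin.
rewrite (bigD1 i)//= [X in _ + X](bigD1 i)//= [leRHS](bigD1 i)//=.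
rewrite !mxE eqxx.
have -> : \prod_(j < n.+1 | j != i) (b' 0 j - a 0 j) =
          \prod_(j < n.+1 | j != i) (b 0 j - a 0 j).
  by apply: eq_bigr => j /negbTE ji; rewrite mxE ji.
have -> : \prod_(j < n.+1 | j != i) (b 0 j - a' 0 j) =
          \prod_(j < n.+1 | j != i) (b 0 j - a 0 j).
  by apply: eq_bigr => j /negbTE ji; rewrite mxE ji.
by rewrite -mulrDl addrC addrA subrK.
Qed.

(** Cutting every set of a cover of [X] by the hyperplane gives covers of the two parts of [X], with
    no increase of the total weight. *)
Lemma caratheodory_halfspace i c :
  (@lebesgue_outer R n.+1).-caratheodory (halfspace i c).
Proof.
apply: le_caratheodory_measurable => X.
pose w := weight0 (@box_volume R n.+1).
have w_ge0 A : (0 <= w A)%E.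
  by rewrite /w /weight0; case: asboolP => // _; exact: box_volume_ge0.
have w_le A : (w A <= box_volume A)%E.
  by rewrite /w /weight0; case: asboolP => // _; exact: box_volume_ge0.
apply: le_ereal_inf_tmp => _ [A XA <-].
pose H := halfspace i c.
apply: (@le_trans _ _
  (\sum_(k <oo) w (A k `&` H) + \sum_(k <oo) w (A k `&` ~` H))%E).
  apply: leeD; apply: ereal_inf_lbound.
    exists (fun k => A k `&` H) => // x [/XA[k _ Ax] Hx]; by exists k.
  exists (fun k => A k `&` ~` H) => // x [/XA[k _ Ax] Hx]; by exists k.
rewrite -nneseriesD//; apply: lee_nneseries => [k _ _|k _].
  by rewrite adde_ge0.
rewrite [leRHS]/weight0; case: asboolP => [->|_].
  by rewrite !set0I /w /weight0 asboolT// adde0.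
apply: le_trans (box_volume_halfspace (A k) i c).
by apply: leeD; exact: w_le.
Qed.

Lemma restr_caratheodory (mu : {outer_measure set E -> \bar R}) D A :
  mu.-caratheodory A -> (restr_outer mu D).-caratheodory A.
Proof.
move=> hA X; rewrite /restr_outer (hA (X `&` D)).
by congr (mu _ + mu _)%E; rewrite setIAC.
Qed.

Variable Om : set E.
Let M := caratheodory_type (vol Om).

Lemma measurable_box (a b : E) : measurable (box a b : set M).
Proof.
have mH i c : measurable (halfspace i c : set M).
  exact: (restr_caratheodory Om (@caratheodory_halfspace i c)).
rewrite (_ : box a b = \big[setI/setT]_(i < n.+1)
    (~` halfspace i (a 0 i) `&` halfspace i (b 0 i))).
  by apply: bigsetI_measurable => i _; apply: measurableI => //; exact: measurableC.
rewrite -bigcap_seq; apply/seteqP; split=> x.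
  move=> xab i _; have /andP[ax xb] := xab i; split=> //.
  by apply/negP; rewrite -leNgt.
by move=> h i; have [/negP] := h i (mem_index_enum i); rewrite -leNgt => -> ->.
Qed.

(** [U] is the union of the countably many boxes with rational corners that it contains. This makes
    continuous functions, and so test functions, measurable for the measure induced by [vol Om]. *)
Lemma measurable_open (U : set E) : open U -> measurable (U : set M).
Proof.
move=> oU.
pose F (pq : 'rV[rat]_n.+1 * 'rV[rat]_n.+1) : set M :=
  if `[< box (map_mx ratr pq.1 : E) (map_mx ratr pq.2) `<=` U >]
  then box (map_mx ratr pq.1 : E) (map_mx ratr pq.2) else set0.
rewrite (_ : U = \bigcup_pq F pq).
  apply: countable_bigcupT_measurable; first exact: countableP.
  by move=> pq; rewrite /F; case: ifP => _ //; exact: measurable_box.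
apply/seteqP; split=> [x Ux|x [pq _]]; last first.
  by rewrite /F; case: asboolP => // + xpq; exact.
have /nbhs_ballP[e e0 xeU] := open_nbhs_nbhs (conj oU Ux).
have hp i : exists q : rat, ratr q \in `]x 0 i - e, x 0 i[.
  by apply: rat_in_itvoo; rewrite ltrBlDr ltrDl.
have hq i : exists q : rat, ratr q \in `]x 0 i, x 0 i + e[.
  by apply: rat_in_itvoo; rewrite ltrDl.
have [p {}hp] := choice hp; have [q {}hq] := choice hq.
exists (\row_i p i, \row_i q i) => //; rewrite /F asboolT /=.
  move=> i; rewrite !mxE; have := hp i; have := hq i; rewrite !in_itv/=.
  by move=> /andP[xq _] /andP[_ px]; rewrite xq ltW.
(* Balls of row vectors are cubes, so the coordinatewise bounds suffice. *)
move=> y ypq; apply: xeU; split=> // j i; rewrite (ord1 j).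
have := ypq i; rewrite !mxE; have := hp i; have := hq i; rewrite !in_itv/=.
move=> /andP[_ qe] /andP[pe _] /andP[py yq].
rewrite /ball/= ltr_norml; apply/andP; split; lra.
Qed.

Lemma measurable_continuous (f : E -> R) : continuous f ->
  measurable_fun setT (f : M -> R).
Proof.
move=> /continuousP cf; apply: (measurability _ (RGenOpens.measurableE R)).
move=> _ [_ [a [b ->]] <-]; rewrite setTI.
exact: measurable_open (cf _ (interval_open _ _)).
Qed.

End borel_caratheodory.

(** * Fields on the domain *)

Section fields.
Context (R : realType) (n : nat).
Local Notation d := n.+1.
Local Notation E := 'rV[R]_d.

Section products.
Implicit Types (a b c : 'rV[R]_d) (A B : 'M[R]_d).

Lemma dotvC a b : dotv a b = dotv b a.
Proof. by apply: eq_bigr => i _; rewrite mulrC. Qed.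

Lemma dotv_lin (k : R) a b c : dotv (k *: a + b) c = k * dotv a c + dotv b c.
Proof.
rewrite /dotv mulr_sumr -big_split; apply: eq_bigr => i _ /=.
by rewrite !mxE mulrDl mulrA.
Qed.

Lemma dotvDl a b c : dotv (a + b) c = dotv a c + dotv b c.
Proof. by have := dotv_lin 1 a b c; rewrite scale1r mul1r. Qed.

Lemma dotvNl a b : dotv (- a) b = - dotv a b.
Proof. by rewrite /dotv -sumrN; apply: eq_bigr => i _; rewrite mxE mulNr. Qed.

Lemma dotvNr a b : dotv a (- b) = - dotv a b.
Proof. by rewrite dotvC dotvNl dotvC. Qed.

Lemma dotv_ge0 a : 0 <= dotv a a.
Proof. by apply: sumr_ge0 => i _; rewrite -expr2 sqr_ge0. Qed.

Lemma frobC A B : frob A B = frob B A.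
Proof. by apply: eq_bigr => i _; apply: eq_bigr => j _; rewrite mulrC. Qed.

Lemma frob_lin (k : R) A B (D : 'M[R]_d) :
  frob (k *: A + B) D = k * frob A D + frob B D.
Proof.
rewrite /frob mulr_sumr -big_split; apply: eq_bigr => i _ /=.
rewrite mulr_sumr -big_split; apply: eq_bigr => j _ /=.
by rewrite !mxE mulrDl mulrA.
Qed.

Lemma frobDl A B (D : 'M[R]_d) : frob (A + B) D = frob A D + frob B D.
Proof. by have := frob_lin 1 A B D; rewrite scale1r mul1r. Qed.

Lemma frob_ge0 A : 0 <= frob A A.
Proof.
by apply: sumr_ge0 => i _; apply: sumr_ge0 => j _; rewrite -expr2 sqr_ge0.
Qed.

End products.

Variable Om : set E.
Local Notation L2 := (Lp (vol Om) 2%:E).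
Implicit Types (u v w p : vector_field R n) (psi xi : scalar_field R n).

Definition L2vec (a : E -> E) : Prop := forall i, L2 (fun x => a x 0 i).
Definition L2mat (A : E -> 'M[R]_d) : Prop := forall i j, L2 (fun x => A x i j).
(** Nothing ties the second component to the first: this is an ambient space containing [H1v Om], on
    which all volume pairings are finite and which is plainly closed under linear combinations. *)
Definition L2field : set (vector_field R n) := [set u | L2vec u.1 /\ L2mat u.2].

Lemma L2vec_lin k a b : L2vec a -> L2vec b -> L2vec (k *: a + b).
Proof.
move=> ha hb i; have := Lp2_lin k (ha i) (hb i); congr Lp.
by apply/funext => x; rewrite !mxE.
Qed.

Lemma L2mat_lin k A B : L2mat A -> L2mat B -> L2mat (k *: A + B).
Proof.
move=> ha hb i j; have := Lp2_lin k (ha i j) (hb i j); congr Lp.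
by apply/funext => x; rewrite !mxE.
Qed.

Lemma L1_dotv a b : L2vec a -> L2vec b -> L1 (vol Om) (fun x => dotv (a x) (b x)).
Proof. by move=> ha hb; apply: L1_sum => i; exact: L2_mul. Qed.

Lemma L1_frob A B : L2mat A -> L2mat B -> L1 (vol Om) (fun x => frob (A x) (B x)).
Proof.
by move=> hA hB; apply: L1_sum => i; apply: L1_sum => j; exact: L2_mul.
Qed.

Lemma H1v_L2field : H1v Om `<=` L2field.
Proof.
move=> u hu; split=> [i|i j]; first by have [] := hu i.
have [_ /(_ j) + _] := hu i; congr Lp; by apply/funext => x; rewrite /= mxE.
Qed.

Lemma L2field_lin_closed : lin_closed L2field.
Proof.
split=> [|k u v [u1 u2] [v1 v2]].
  by split=> [i|i j]; have := Lp2_0 (vol Om); congr Lp;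
    apply/funext => x; rewrite mxE.
by split; [exact: (L2vec_lin k u1 v1) | exact: (L2mat_lin k u2 v2)].
Qed.

(** Its [qnorm] is [H1vnorm Om] by conversion, so the results on semi-inner products apply to the
    norms in [time_C2] and [Uspace]. *)
Definition H1v_ip u w : R :=
  integ (vol Om) (fun x => dotv (u.1 x) (w.1 x) + frob (u.2 x) (w.2 x)).

Lemma H1v_ip_semi_inner : semi_inner L2field H1v_ip.
Proof.
have L1ip u w : L2field u -> L2field w ->
    L1 (vol Om) (fun x => dotv (u.1 x) (w.1 x) + frob (u.2 x) (w.2 x)).
  by move=> [u1 u2] [w1 w2]; apply: L1D; [exact: L1_dotv | exact: L1_frob].
split; first split.
- by move=> u w _ _; apply: eq_integ => x; rewrite dotvC frobC.
- move=> k u v w hu hv hw; rewrite /H1v_ip -integ_lin; [|exact: L1ip|exact: L1ip].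
  apply: eq_integ => x.
  rewrite (_ : (k *: u + v).1 x = k *: u.1 x + v.1 x)//.
  rewrite (_ : (k *: u + v).2 x = k *: u.2 x + v.2 x)//.
  by rewrite dotv_lin frob_lin; ring.
- by move=> u _; apply: integ_ge0 => x; rewrite addr_ge0 ?dotv_ge0 ?frob_ge0.
Qed.

Section rho.
Variable rho : E -> R.
Hypothesis hrho : Lp (vol Om) +oo%E rho.

Lemma L1_rho_ip u w : L2field u -> L2field w ->
  L1 (vol Om) (fun x => rho x * dotv (u.1 x) (w.1 x)).
Proof.
have [M _ hM] := Lp_oo_bounded hrho; move=> [u1 _] [w1 _].
by apply: (ess_bounded_mul hM); exact: L1_dotv.
Qed.

Lemma rho_ip_sym_bilinear : sym_bilinear L2field (rho_ip Om rho).
Proof.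
split=> [u w _ _|k u v w hu hv hw].
  by apply: eq_integ => x; rewrite dotvC.
rewrite /rho_ip -integ_lin; [|exact: L1_rho_ip|exact: L1_rho_ip].
apply: eq_integ => x.
by rewrite (_ : (k *: u + v).1 x = k *: u.1 x + v.1 x)// dotv_lin; ring.
Qed.

(** By [sym_bilinear_bounded] it is enough to bound the diagonal, where an essential bound of [rho]
    and the dropped gradient term give [M * H1v_ip u u]. *)
Lemma rho_ip_bounded : exists K, forall u w, L2field u -> L2field w ->
  `|rho_ip Om rho u w| <= K * (H1vnorm Om u * H1vnorm Om w).
Proof.
have [M M0 hM] := Lp_oo_bounded hrho; exists (3 * M).
apply: (sym_bilinear_bounded L2field_lin_closed H1v_ip_semi_inner
  rho_ip_sym_bilinear M0) => u [u1 u2].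
apply: (le_trans (ess_bounded_integ hM (L1_dotv u1 u1) _)) => [x|].
  exact: dotv_ge0.
rewrite ler_wpM2l// /H1v_ip integD; [|exact: L1_dotv|exact: L1_frob].
by rewrite lerDl; apply: integ_ge0 => x; exact: frob_ge0.
Qed.

Lemma rho_ip_zero u w : L2field u -> L2field w -> zero_v Om u ->
  rho_ip Om rho u w = 0.
Proof.
move=> hu hw u0; have h := L1_rho_ip hu hw.
rewrite /rho_ip (ae_eq_integ h (L1_0 _)).
  by rewrite /integ Rintegral_cst// mul0r.
apply: filterS u0 => x [u0 _]; have -> : u.1 x = 0 by rewrite u0.
by rewrite -[0](subrr 0) dotvDl dotvNl subrr mulr0.
Qed.

End rho.

Section coefficients.
Variables (C : E -> 'I_d -> 'I_d -> 'I_d -> 'I_d -> R)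
  (Ee : E -> 'I_d -> 'I_d -> 'I_d -> R) (kappa : E -> 'M[R]_d).
Hypotheses (hC : admissible_C Om C) (hE : admissible_E Om Ee)
  (hk : admissible_kappa Om kappa).

Lemma L2mat_eps u : L2mat u.2 -> L2mat (eps u).
Proof.
move=> hu i j; have := Lp2Z 2^-1 (Lp2D (hu i j) (hu j i)); congr Lp.
by apply/funext => x; rewrite !mxE.
Qed.

Lemma L2mat_app_C A : L2mat A -> L2mat (fun x => app_C C x (A x)).
Proof.
move=> hA i j; have [hC' _ _ _] := hC.
rewrite (_ : (fun x => _) = fun x => \sum_k \sum_l C x i j k l * A x k l).
  by apply: Lp2_sum => k; apply: Lp2_sum => l; exact: Lp_oo_mul_Lp2.
by apply/funext => x; rewrite mxE.
Qed.

Lemma L2mat_app_E b : L2vec b -> L2mat (fun x => app_E Ee x (b x)).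
Proof.
move=> hb i j; rewrite (_ : (fun x => _) = fun x => \sum_k Ee x i j k * b x 0 k).
  by apply: Lp2_sum => k; apply: Lp_oo_mul_Lp2; [exact: hE.1 | exact: hb].
by apply/funext => x; rewrite mxE.
Qed.

Lemma L2vec_app_ET A : L2mat A -> L2vec (fun x => app_ET Ee x (A x)).
Proof.
move=> hA k; rewrite (_ : (fun x => _) = fun x => \sum_i \sum_j Ee x i j k * A x i j).
  apply: Lp2_sum => i; apply: Lp2_sum => j.
  by apply: Lp_oo_mul_Lp2; [exact: hE.1 | exact: hA].
by apply/funext => x; rewrite mxE.
Qed.

Lemma L2vec_app_kappa b : L2vec b -> L2vec (fun x => app_kappa kappa x (b x)).
Proof.
have [hk' _ _] := hk.
move=> hb i; rewrite (_ : (fun x => _) = fun x => \sum_j kappa x i j * b x 0 j).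
  by apply: Lp2_sum => j; exact: Lp_oo_mul_Lp2.
by apply/funext => x; rewrite mxE; apply: eq_bigr => j _; rewrite mxE mulrC.
Qed.

(** The coupling has opposite signs in the two equations; negating the scalar test function gives
    both coupling terms, [E grad psi : eps p] and [E grad xi : eps u], a plus sign, and they change
    places under the swap. The elastic and dielectric parts are symmetric because [C] and [kappa]
    are. *)
Lemma aform_swap u psi p xi : L2field u -> L2vec psi.2 -> L2field p -> L2vec xi.2 ->
  aform Om C Ee kappa u psi p (- xi) = aform Om C Ee kappa p xi u (- psi).
Proof.
have L1a (v : vector_field R n) (phi : scalar_field R n) :
    L2field v -> L2vec phi.2 -> forall w (eta : scalar_field R n),
    L2field w -> L2vec eta.2 ->
    L1 (vol Om) (fun x =>
      frob (app_C C x (eps v x) + app_E Ee x (phi.2 x)) (eps w x)) /\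
    L1 (vol Om) (fun x =>
      dotv (- app_ET Ee x (eps v x) + app_kappa kappa x (phi.2 x)) ((- eta).2 x)).
  move=> [_ hv] hphi w eta [_ hw] heta; split.
    apply: L1_frob; last exact: L2mat_eps.
    have := L2mat_lin 1 (L2mat_app_C (L2mat_eps hv)) (L2mat_app_E hphi).
    by rewrite scale1r.
  apply: (@L1_dotv _ (- eta).2).
    have := L2vec_lin (-1) (L2vec_app_ET (L2mat_eps hv)) (L2vec_app_kappa hphi).
    by rewrite scaleN1r.
  move=> i; have := Lp2N (heta i); congr Lp.
  by apply/funext => x; rewrite (_ : (- eta).2 x = - eta.2 x)// mxE.
move=> hu hpsi hp hxi.
have [h1 h2] := L1a _ _ hu hpsi _ _ hp hxi.
have [h3 h4] := L1a _ _ hp hxi _ _ hu hpsi.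
rewrite /aform -!integD//; apply: ae_eq_integ; [exact: L1D|exact: L1D|].
have [_ _ Csym _] := hC; have [_ ksym _] := hk.
apply: filterS2 Csym ksym => x Cx kx.
have ka (a b : E) : dotv (app_kappa kappa x a) b = dotv (app_kappa kappa x b) a.
  have kE (a' b' : E) : dotv a' b' = (a' *m b'^T) 0 0.
    by rewrite /dotv mxE; apply: eq_bigr => i _; rewrite mxE.
  rewrite [RHS]dotvC !kE /app_kappa !trmx_mul trmxK mulmxA.
  by move: kx; rewrite /symmetric => ->.
rewrite (_ : (- xi).2 x = - xi.2 x)// (_ : (- psi).2 x = - psi.2 x)//.
rewrite !frobDl !dotvDl !dotvNl !dotvNr opprK !app_ETE.
rewrite Cx (frobC (eps u x) (app_C _ _ _)) (frobC (app_E _ _ (psi.2 x))).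
rewrite (frobC (app_E _ _ (xi.2 x))) (ka (psi.2 x)).
ring.
Qed.

End coefficients.
End fields.

Lemma semi_inner_sub (R : realType) (V : lmodType R) (X Y : set V) Q :
  Y `<=` X -> semi_inner X Q -> semi_inner Y Q.
Proof.
move=> YX [[Qs Ql] Qp]; split; first split.
- by move=> u v /YX Xu /YX Xv; exact: Qs.
- by move=> a u v w /YX Xu /YX Xv /YX Xw; exact: Ql.
- by move=> u /YX; exact: Qp.
Qed.

(** * Test functions, and linearity of the spaces of fields, controls and states *)

Section test_functions.
Context (R : realType) (V : normedModType R) (U : set V) (phi : V -> R).
Hypothesis hphi : test_function U phi.

Let bounded_of_support (f : V -> R) K : continuous f -> compact K ->
  (forall x, ~ K x -> f x = 0) -> exists M, forall x, `|f x| <= M.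
Proof.
move=> cf cK f0.
have /compact_bounded /pinfty_ex_gt0[M M0 fM] : compact (f @` K).
  by apply: continuous_compact => //; exact: continuous_subspaceT.
exists M => x; have [Kx|/f0 ->] := pselect (K x); last by rewrite normr0 ltW.
by apply: fM; exists x.
Qed.

Lemma test_function_bounded : continuous phi /\ exists M, forall x, `|phi x| <= M.
Proof.
have [cphi [K [cK KU phi0]]] := hphi.
by have [c0 _] := cphi 0%N; split=> //; exact: bounded_of_support phi0.
Qed.

(** Off the compact [K] the function is locally zero, [K] being closed, so the derivative is
    supported in [K] as well. *)
Lemma test_function_derive_bounded v : continuous (fun x => 'D_v phi x) /\
  exists M, forall x, `|'D_v phi x| <= M.
Proof.
have [cphi [K [cK KU phi0]]] := hphi.
have [_ /(_ v)[_ [cD _]]] := cphi 1%N; split=> //.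
apply: (bounded_of_support cD cK) => x Kx.
rewrite -[RHS](derive_cst (0 : R) x v); apply: near_eq_derive.
have oK : open (~` K).
  by apply: closed_openC; apply: compact_closed => //; exact: norm_hausdorff.
by apply: filterS (open_nbhs_nbhs (conj oK Kx)) => y /phi0.
Qed.

End test_functions.

Section sobolev_spaces.
Context (R : realType) (n : nat).
Local Notation d := n.+1.
Local Notation E := 'rV[R]_d.
Variables (Om GamD : set E) (gam : scalar_field R n -> E -> R).
Hypotheses (H1_1 : H1 Om (const_field n (1 : R))) (hgam : is_trace Om gam).
Implicit Types (v w : scalar_field R n) (u : vector_field R n).

(** The weak gradient identity is additive once its integrands are integrable: the constant 1 is
    square integrable on [Om], which gives [L2] inside [L1], and test functions and their
    derivatives are measurable and bounded. *)
Lemma H1_lin (a : R) v w : H1 Om v -> H1 Om w -> H1 Om (a *: v + w).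
Proof.
move=> [v1 v2 dv] [w1 w2 dw]; have [one _ _] := H1_1.
have L1_of (f : E -> R) : Lp (vol Om) 2%:E f -> L1 (vol Om) f.
  by move=> hf; have := L2_mul hf one; under eq_fun do rewrite mulr1.
have L1M (f g : E -> R) : Lp (vol Om) 2%:E f ->
    continuous g /\ (exists M, forall x, `|g x| <= M) ->
    L1 (vol Om) (fun x => f x * g x).
  move=> hf [cg [M gM]]; under eq_fun do rewrite mulrC.
  apply: (@ess_bounded_mul _ _ _ _ M); last exact: L1_of.
  by split; [exact: measurable_continuous | exact: nearW].
split=> [|i|phi hphi i]; first exact: Lp2_lin.
- have := Lp2_lin a (v2 i) (w2 i); congr Lp.
  by apply/funext => x; rewrite (_ : (a *: v + w).2 x = a *: v.2 x + w.2 x)// !mxE.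
- have hd := test_function_derive_bounded hphi (delta_mx 0 i).
  have h := test_function_bounded hphi.
  rewrite /L2ip (@eq_integ _ _ _ _ (fun x =>
      a * (v.1 x * 'D_(delta_mx 0 i) phi x) + w.1 x * 'D_(delta_mx 0 i) phi x)).
    rewrite integ_lin; [|exact: L1M|exact: L1M].
    rewrite [X in a * X](dv _ hphi) [X in _ + X](dw _ hphi).
    rewrite (@eq_integ _ _ _ _ (fun x => a * (v.2 x 0 i * phi x) + w.2 x 0 i * phi x)).
      rewrite integ_lin; [|exact: (L1M (fun x => v.2 x 0 i))|].
        by rewrite mulrN opprD.
      exact: (L1M (fun x => w.2 x 0 i)).
    move=> x; rewrite (_ : (a *: v + w).2 x = a *: v.2 x + w.2 x)// !mxE.
    by rewrite mulrDl mulrA.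
  by move=> x; rewrite (_ : (a *: v + w).1 x = a * v.1 x + w.1 x)// mulrDl mulrA.
Qed.

Let component_lin (a : R) (u u' : vector_field R n) i :
  component i (a *: u + u') = a *: component i u + component i u'.
Proof.
congr pair; apply/funext => x.
  by rewrite /= (_ : (a *: u.1 + u'.1) x = a *: u.1 x + u'.1 x)// !mxE.
rewrite /= (_ : (a *: u.2 + u'.2) x = a *: u.2 x + u'.2 x)//.
by apply/matrixP => k j; rewrite !mxE.
Qed.

Lemma H1D_lin (a : R) (u u' : vector_field R n) : H1D Om gam GamD u ->
  H1D Om gam GamD u' -> H1D Om gam GamD (a *: u + u').
Proof.
move=> [hu u0] [hu' u'0]; split=> i; rewrite component_lin.
  exact: H1_lin.
have [_ /(_ a _ _ (hu i) (hu' i)) gl _ _] := hgam.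
move: gl (u0 i) (u'0 i); apply: filterS3 => x -> h h' xD.
by rewrite h// h'// mulr0 addr0.
Qed.

Lemma trace_opp v : H1 Om v -> ae (surf Om) (fun x => gam (- v) x = - gam v x).
Proof.
move=> hv; have [_ /(_ (-2) _ _ hv hv) + _ _] := hgam.
(* The trace is linear on combinations [a *: v + w] of two [H1] fields; with [a = -2] and [w = v]
   the single field [v] is enough. *)
rewrite (_ : -2 *: v + v = - v); last first.
  by rewrite -{2}[v]scale1r -scalerDl (_ : -2 + 1 = -1 :> R) ?scaleN1r//; ring.
by apply: filterS => x ->; ring.
Qed.

(** Finiteness of the surface measure, read off the trace operator: the trace of the constant field
    1 is square integrable and equals 1 almost everywhere. It makes boundary [L2] functions
    integrable, so that the mean-zero condition is linear. *)
Lemma surf_one : Lp (surf Om) 2%:E (fun=> 1).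
Proof.
have [/(_ _ H1_1) h1 _ _ /(_ _ H1_1) h2] := hgam.
apply: (ae_eq_Lp2 _ h1); first exact: measurable_cst.
by apply: h2; apply: continuous_subspaceT; exact: (@cst_continuous _ _ (1 : R)).
Qed.

Lemma L20bdry_L2 : L20bdry Om `<=` L2bdry Om.
Proof. by move=> z []. Qed.

Lemma L20bdry_lin_closed : lin_closed (L20bdry Om).
Proof.
have L1_of (f : E -> R) : L2bdry Om f -> L1 (surf Om) f.
  by move=> hf; have := L2_mul hf surf_one; under eq_fun do rewrite mulr1.
split.
  split; first exact: Lp2_0.
  by rewrite /integ Rintegral_cst// mul0r.
move=> a z y [hz z0] [hy y0]; split; first exact: Lp2_lin.
rewrite (_ : a *: z + y = fun x => a * z x + y x)//.
by rewrite integ_lin ?z0 ?y0 ?mulr0 ?addr0//; exact: L1_of.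
Qed.

Lemma L20bdry_semi_inner : semi_inner (L20bdry Om) (L2ip (surf Om)).
Proof. exact: semi_inner_sub L20bdry_L2 (L2ip_semi_inner _). Qed.

Lemma Zspace_lin (T : R) (a : R) (z y : control R n) : Zspace Om T z ->
  Zspace Om T y -> Zspace Om T (a *: z + y).
Proof.
have hX := L20bdry_lin_closed; have hQ := L20bdry_semi_inner.
move=> [z1 z2 dz cz z0] [y1 y2 dy cy y0].
have [[z1X _ _] [z2X _ _]] := (z1, z2).
have [[y1X _ _] [y2X _ _]] := (y1, y2).
split.
- exact: (bochner_L2_lin hX hQ a z1 y1).
- exact: (bochner_L2_lin hX hQ a z2 y2).
- exact: (weak_time_derivative_lin hX hQ a z1X y1X z2X y2X dz dy).
- exact: (time_continuous_lin hX hQ a z1X y1X cz cy).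
- move: z0 y0; apply: filterS2 => x zx yx.
  by rewrite (_ : _ x = a * z.1 0 x + y.1 0 x)// zx yx mulr0 addr0.
Qed.

Lemma Uspace_lin (T : R) (a : R) (f g : R -> vector_field R n) :
  Uspace Om gam GamD T f -> Uspace Om gam GamD T g ->
  Uspace Om gam GamD T (a *: f + g).
Proof.
move=> [fH cf] [gH cg]; split=> [t tT|].
  by apply: H1D_lin; [exact: fH | exact: gH].
have fX : time_in (L2field Om) T f by move=> t /fH[/H1v_L2field].
have gX : time_in (L2field Om) T g by move=> t /gH[/H1v_L2field].
exact: (time_continuous_lin (L2field_lin_closed Om) (H1v_ip_semi_inner Om)
  a fX gX cf cg).
Qed.

End sobolev_spaces.

Lemma fin_dim_s_opp (R : realType) (n : nat) (Om : set 'rV[R]_n.+1)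
    (W : set (scalar_field R n)) (v : scalar_field R n) :
  fin_dim_s Om W -> W v -> W (- v).
Proof.
move=> [m [b hb]] /hb[c hc]; apply/hb; exists (fun i => - c i).
under eq_bigr do rewrite scaleNr; rewrite sumrN.
by apply: filterS hc => x [h1 h2]; split; [congr (- _) | congr (- _)].
Qed.

(** * Duality between the state and the adjoint equations *)

Section time_integral.
Context (R : realType) (T : R).
Implicit Types f g : R -> R.

Definition tintegrable f : Prop :=
  lebesgue_measure.-integrable `[0, T] (EFin \o f).

Definition tint f : R := \int[lebesgue_measure]_(t in `[0, T]) f t.

Lemma eq_tint f g : (forall t, t \in `[0, T] -> f t = g t) -> tint f = tint g.
Proof. by move=> fg; apply: eq_Rintegral => t; rewrite inE; exact: fg. Qed.

Lemma eq_tintegrable f g : (forall t, t \in `[0, T] -> f t = g t) ->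
  tintegrable f -> tintegrable g.
Proof.
by move=> fg; apply: eq_integrable => // t; rewrite inE => tT /=; rewrite fg.
Qed.

Lemma tintegrable_lin a f g : tintegrable f -> tintegrable g ->
  tintegrable (fun t => a * f t + g t).
Proof.
move=> hf hg; have haf := integrableZl _ a hf.
have := integrableD _ (haf _) hg.
by move=> /(_ (measurable_itv _) (measurable_itv _)); apply: eq_integrable.
Qed.

Lemma tint_lin a f g : tintegrable f -> tintegrable g ->
  tint (fun t => a * f t + g t) = a * tint f + tint g.
Proof.
move=> hf hg; rewrite /tint RintegralD//; first by rewrite RintegralZl.
by have haf := integrableZl _ a hf; apply: haf; exact: measurable_itv.
Qed.

Lemma tintegrable_continuous f : {within `[0, T], continuous f} -> tintegrable f.
Proof. by apply: continuous_compact_integrable; exact: segment_compact. Qed.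

End time_integral.

Section adjoint_duality.
Context (R : realType) (n : nat).
Local Notation E := 'rV[R]_n.+1.
Variables (Om GamD : set E) (T : R)
  (C : E -> 'I_n.+1 -> 'I_n.+1 -> 'I_n.+1 -> 'I_n.+1 -> R)
  (Ee : E -> 'I_n.+1 -> 'I_n.+1 -> 'I_n.+1 -> R)
  (kappa : E -> 'M[R]_n.+1) (rho : E -> R)
  (gam : scalar_field R n -> E -> R) (G : scalar_field R n -> R)
  (Vh : set (vector_field R n)) (Wh : set (scalar_field R n)).
Hypotheses (T0 : 0 < T) (hC : admissible_C Om C) (hE : admissible_E Om Ee)
  (hk : admissible_kappa Om kappa) (hrho : admissible_rho Om rho)
  (hgam : is_trace Om gam) (hG : is_bounded_functional Om G)
  (VhD : Vh `<=` H1D Om gam GamD) (WhH : Wh `<=` H1 Om) (Whf : fin_dim_s Om Wh).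

Let WhG := Wh `&` H1G Om G.

Let WhG_opp v : WhG v -> WhG (- v).
Proof.
move=> [Wv [Hv Gv]]; have WNv := fin_dim_s_opp Whf Wv.
split=> //; split; first exact: WhH.
have [/(_ (-2) _ _ Hv Hv) + _] := hG.
rewrite (_ : -2 *: v + v = - v); last first.
  by rewrite -{2}[v]scale1r -scalerDl (_ : -2 + 1 = -1 :> R) ?scaleN1r//; ring.
by rewrite Gv mulr0 addr0.
Qed.

Let VhL2 : Vh `<=` L2field Om.
Proof. by move=> u /VhD[/H1v_L2field]. Qed.

(* The state equation is tested with [(p, - xi)] and the adjoint one with
   [(u, - psi)], which makes the stationary terms coincide. *)
Lemma state_adjoint_identity z f u psi p xi :
  (forall t, t \in `[0, T] -> L2bdry Om (z t)) ->
  solves_state Om C Ee kappa rho gam T Vh WhG z u psi ->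
  solves_adjoint Om C Ee kappa rho T Vh WhG f p xi ->
  let g t := rho_ip Om rho (f t) (u t) - L2ip (surf Om) (gam (xi t)) (z t) in
  {within `[0, T], continuous g} /\ tint T g = 0.
Proof.
move=> zL2 [u' [u'' [uC2 psiW _ [u0 u'0] ueq]]] [p' [p'' [pC2 xiW _ [pT p'T] peq]]] g.
have [uV _ _ _] := uC2; have [pV _ _ _] := pC2.
have hB := rho_ip_sym_bilinear hrho.1.
have [K BK] := rho_ip_bounded hrho.1.
have gE t : t \in `[0, T] ->
    rho_ip Om rho (p'' t) (u t) - rho_ip Om rho (u'' t) (p t) = g t.
  move=> tT; have [Vu Vu' Vu''] := uV t tT; have [Vp Vp' Vp''] := pV t tT.
  have [Wpsi Wxi] := (psiW t tT, xiW t tT).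
  have e1 := ueq _ _ t Vp (WhG_opp Wxi) tT.
  have e2 := peq _ _ t Vu (WhG_opp Wpsi) tT.
  have [_ psi2 _] := WhH Wpsi.1; have [_ xi2 _] := WhH Wxi.1.
  have e3 := aform_swap hC hE hk (VhL2 Vu) psi2 (VhL2 Vp) xi2.
  (* The trace of [- xi t] is the opposite trace only almost everywhere, so the replacement is made
     inside the [L2] product. *)
  have e4 : L2ip (surf Om) (z t) (gam (- xi t)) = - L2ip (surf Om) (gam (xi t)) (z t).
    have [gL2 _ _ _] := hgam; have Hxi := WhH Wxi.1.
    have HNxi := WhH (WhG_opp Wxi).1.
    have [hsym _] := L2ip_semi_inner (surf Om).
    rewrite hsym.1; [|exact: zL2|exact: gL2].
    rewrite (L2_ae (gL2 _ HNxi) (Lp2N (gL2 _ Hxi)) (trace_opp hgam Hxi))//; last exact: zL2.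
    have := bilZl (Lp2_lin_closed (surf Om)) hsym (-1) (gL2 _ Hxi) (zL2 t tT).
    rewrite mulN1r => <-; apply: eq_integ => x.
    by rewrite (_ : (-1 *: gam (xi t)) x = -1 * gam (xi t) x)// mulN1r.
  move: e1 e2; rewrite /g e3 e4; lra.
have [cg ig] := integral_wronskian (L2field_lin_closed Om) (H1v_ip_semi_inner Om)
  hB BK T0 VhL2 pC2 uC2.
split.
  apply: subspace_eq_continuous cg => t; rewrite inE => tT; exact: gE.
rewrite -(eq_tint gE) /tint ig.
have I0 : 0 \in `[0, T] by rewrite in_itv/= lexx ltW.
have IT : T \in `[0, T] by rewrite in_itv/= lexx ltW.
have [Vu0 Vu'0 _] := uV _ I0; have [VuT Vu'T _] := uV _ IT.
have [Vp0 Vp'0 _] := pV _ I0; have [VpT Vp'T _] := pV _ IT.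
(* The terms at [T] vanish by the final conditions on [p], those at 0 by the initial conditions on
   [u]. *)
rewrite (rho_ip_zero hrho.1 _ _ p'T); [|exact: VhL2|exact: VhL2].
rewrite (hB.1 (u' T))//; [|exact: VhL2|exact: VhL2].
rewrite (rho_ip_zero hrho.1 _ _ pT); [|exact: VhL2|exact: VhL2].
rewrite (rho_ip_zero hrho.1 _ _ u'0); [|exact: VhL2|exact: VhL2].
rewrite (hB.1 (p' 0))//; [|exact: VhL2|exact: VhL2].
rewrite (rho_ip_zero hrho.1 _ _ u0); [|exact: VhL2|exact: VhL2].
by rewrite !subr0.
Qed.

Variables (Sh : (R -> E -> R) -> R -> vector_field R n)
  (Rh : (R -> vector_field R n) -> R -> E -> R).
Hypotheses (hSh : is_state_operator Om gam T C Ee kappa rho Vh WhG Sh)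
  (hRh : is_adjoint_operator Om gam GamD T C Ee kappa rho Vh WhG Rh).

Lemma state_Uspace (z : control R n) : Zspace Om T z -> Uspace Om gam GamD T (Sh z.1).
Proof.
move=> /hSh[psi [u' [u'' [[uV du _ _] _ _ _ _]]]]; split=> [t tT|].
  by apply: VhD; have [] := uV t tT.
apply: (time_derivative_continuous (L2field_lin_closed Om) (H1v_ip_semi_inner Om) _ _ du).
  by move=> t /uV[/VhL2].
by move=> t /uV[_ /VhL2].
Qed.

Lemma Uspace_rho_ip_continuous f g : Uspace Om gam GamD T f ->
  Uspace Om gam GamD T g ->
  {within `[0, T], continuous (fun t => rho_ip Om rho (f t) (g t))}.
Proof.
move=> [fH cf] [gH cg]; have [K BK] := rho_ip_bounded hrho.1.
have fX : time_in (L2field Om) T f by move=> t /fH[/H1v_L2field].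
have gX : time_in (L2field Om) T g by move=> t /gH[/H1v_L2field].
exact: (time_continuous_form (Q := H1v_ip Om) (L2field_lin_closed Om)
  (rho_ip_sym_bilinear hrho.1) BK fX gX cf cg).
Qed.

Lemma adjoint_L2bdry f t : Uspace Om gam GamD T f -> t \in `[0, T] ->
  L2bdry Om (Rh f t).
Proof.
move=> /hRh[p [xi [[p' [p'' [_ xiW _ _ _]]] RhE]]] tT; rewrite RhE//.
by have [+ _ _ _] := hgam; apply; exact: WhH (xiW t tT).1.
Qed.

(** Integrability of the boundary pairing is obtained without studying [Rh f] as a function of time:
    [rho_ip (f t) (Sh z.1 t)] is continuous, and so is its difference with the pairing, being the
    derivative of a Wronskian. *)
Lemma adjoint_duality (z : control R n) f : Zspace Om T z ->
  Uspace Om gam GamD T f ->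
  tintegrable T (fun t => L2ip (surf Om) (Rh f t) (z.1 t)) /\
  tint T (fun t => rho_ip Om rho (f t) (Sh z.1 t)) =
  tint T (fun t => L2ip (surf Om) (Rh f t) (z.1 t)).
Proof.
move=> hz hf; have [psi hu] := hSh hz; have [p [xi [hp RhE]]] := hRh hf.
have zL2 t : t \in `[0, T] -> L2bdry Om (z.1 t).
  by have [[zX _ _] _ _ _ _] := hz; move=> /zX[].
have [cg ig] := state_adjoint_identity zL2 hu hp.
have iu := tintegrable_continuous (Uspace_rho_ip_continuous hf (state_Uspace hz)).
have iz := tintegrable_lin (-1) (tintegrable_continuous cg) iu.
have zE t : t \in `[0, T] -> -1 * (rho_ip Om rho (f t) (Sh z.1 t) -
      L2ip (surf Om) (gam (xi t)) (z.1 t)) + rho_ip Om rho (f t) (Sh z.1 t) =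
    L2ip (surf Om) (Rh f t) (z.1 t).
  by move=> tT; rewrite RhE//; ring.
split; first exact: eq_tintegrable zE iz.
by rewrite -(eq_tint zE) tint_lin// ?ig ?mulr0 ?add0r//; exact: tintegrable_continuous.
Qed.

End adjoint_duality.

(** * Quadratic expansion of the functional along a line *)

Theorem proposition3p8 (R : realType) (n : nat)
    (Om GamD GamN : set 'rV[R]_n.+1) (T : R)
    (C : 'rV[R]_n.+1 -> 'I_n.+1 -> 'I_n.+1 -> 'I_n.+1 -> 'I_n.+1 -> R)
    (Ee : 'rV[R]_n.+1 -> 'I_n.+1 -> 'I_n.+1 -> 'I_n.+1 -> R)
    (kappa : 'rV[R]_n.+1 -> 'M[R]_n.+1) (rho : 'rV[R]_n.+1 -> R)
    (gam : scalar_field R n -> 'rV[R]_n.+1 -> R) (G : scalar_field R n -> R)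
    (Vh : set (vector_field R n)) (Wh : set (scalar_field R n))
    (Sh : (R -> 'rV[R]_n.+1 -> R) -> R -> vector_field R n)
    (Rh : (R -> vector_field R n) -> R -> 'rV[R]_n.+1 -> R)
    (ud : R -> vector_field R n) (alpha : R) :
  lipschitz_domain Om ->
  boundary_partition (bdry Om) GamD GamN ->
  0 < T ->
  admissible_C Om C ->
  admissible_E Om Ee ->
  admissible_kappa Om kappa ->
  admissible_rho Om rho ->
  is_trace Om gam ->
  is_bounded_functional Om G ->
  G (const_field n (1 : R)) <> 0 ->
  Vh `<=` H1D Om gam GamD ->
  fin_dim_v Om Vh ->
  Wh `<=` H1 Om ->
  fin_dim_s Om Wh ->
  (forall c : R, Wh (const_field n c)) ->
  is_state_operator Om gam T C Ee kappa rho Vh (Wh `&` H1G Om G) Sh ->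
  is_adjoint_operator Om gam GamD T C Ee kappa rho Vh (Wh `&` H1G Om G) Rh ->
  Uspace Om gam GamD T ud ->
  zero_v Om (ud 0) ->
  0 < alpha ->
  forall z y : control R n, Zspace Om T z -> Zspace Om T y ->
    is_gateaux_derivative (jh Om T rho Sh ud alpha) z y
      (let beta := Rh (fun t => Sh z.1 t - ud t) in
       \int[lebesgue_measure]_(t in `[0, T]) L2ip (surf Om) (beta t) (y.1 t) +
       alpha * \int[lebesgue_measure]_(t in `[0, T])
                 L2ip (surf Om) (z.2 t) (y.2 t)).
Proof.
move=> hOm hpart T0 hC hE hk hrho hgam hG G1 VhD Vhf WhH Whf Wh1 hSh hRh ud_U ud0 a0.
move=> z y hz hy.
have H1_1 : H1 Om (const_field n (1 : R)) by apply: WhH; exact: Wh1.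
have hB := rho_ip_sym_bilinear hrho.1.
have hL2 := L2field_lin_closed Om.
have dual (w : control R n) f (hw : Zspace Om T w) (hf : Uspace Om gam GamD T f) :=
  adjoint_duality T0 hC hE hk hrho hgam hG VhD WhH Whf hSh hRh hw hf.
have SU (w : control R n) (hw : Zspace Om T w) := state_Uspace VhD hSh hw.
have inU f t : Uspace Om gam GamD T f -> t \in `[0, T] -> L2field Om (f t).
  by move=> [fH _] tT; have [/H1v_L2field] := fH t tT.
have rint f g (hf : Uspace Om gam GamD T f) (hg : Uspace Om gam GamD T g) :=
  tintegrable_continuous (Uspace_rho_ip_continuous hrho hf hg).
have zL2 (v : control R n) t : Zspace Om T v -> t \in `[0, T] -> L2bdry Om (v.1 t).
  by move=> [[vX _ _] _ _ _ _] /vX[].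
pose D f g := tint T (fun t => rho_ip Om rho (f t) (g t)).
pose L g := tint T (fun t => L2ip (surf Om) (Rh g t) (y.1 t)).
pose f : R -> vector_field R n := fun t => Sh z.1 t - ud t.
pose w := Sh y.1.
have hf : Uspace Om gam GamD T f.
  have := Uspace_lin H1_1 hgam (-1) ud_U (SU _ hz); congr Uspace.
  by apply/funext => t; rewrite /f !fctE /= scaleN1r addrC.
have hw : Uspace Om gam GamD T w by exact: SU.
pose N2 (a b : R -> 'rV[R]_n.+1 -> R) := tint T (fun t => L2ip (surf Om) (a t) (b t)).
suff jhE s : s != 0 ->
    jh Om T rho Sh ud alpha (z + s *: y) - jh Om T rho Sh ud alpha z =
    s * (L f + alpha * N2 z.2 y.2) + s ^+ 2 * (2^-1 * L w + alpha / 2 * N2 y.2 y.2).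
  rewrite /is_gateaux_derivative.
  have lim : (L f + alpha * N2 z.2 y.2) + s * (2^-1 * L w + alpha / 2 * N2 y.2 y.2)
      @[s --> (0 : R)^'] --> L f + alpha * N2 z.2 y.2.
    rewrite -[X in _ --> X]addr0; apply: cvgD; first exact: cvg_cst.
    apply: cvg0Mr; apply: cvg_within.
  apply: cvg_trans lim; apply: near_eq_cvg.
  rewrite /dnbhs near_withinE; near=> s => s0.
  rewrite (jhE _ s0); move: (_ + alpha * _) (_ * L w + _) => b c; by field.
move=> s0.
have zsE : z + s *: y = s *: y + z by rewrite addrC.
have hzs : Zspace Om T (z + s *: y).
  by rewrite zsE; exact: (Zspace_lin H1_1 hgam).
pose us := Sh (z + s *: y).1.
have hus : Uspace Om gam GamD T us by exact: SU.
pose e : R -> vector_field R n := fun t => us t - Sh z.1 t.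
have he : Uspace Om gam GamD T e.
  have := Uspace_lin H1_1 hgam (-1) (SU _ hz) hus; congr Uspace.
  by apply/funext => t; rewrite /e !fctE /= scaleN1r addrC.
have De g : Uspace Om gam GamD T g -> D g e = s * L g.
  move=> hg.
  have [i1 d1] := dual _ _ hzs hg; have [i2 d2] := dual _ _ hz hg.
  have [i3 _] := dual _ _ hy hg.
  have -> : D g e = D g us - D g (Sh z.1).
    rewrite addrC -mulN1r -tint_lin; [|exact: rint hg (SU _ hz)|exact: rint hg hus].
    apply: eq_tint => t tT; rewrite mulN1r addrC.
    exact: (bilBr hL2 hB (inU _ _ hus tT) (inU _ _ (SU _ hz) tT) (inU _ _ hg tT)).
  rewrite /D d1 d2 /L.
  apply/eqP; rewrite subr_eq -tint_lin//; apply/eqP.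
  apply: eq_tint => t tT.
  have hR := adjoint_L2bdry hgam WhH hRh hg tT.
  have [hS hl] := (L2ip_semi_inner (surf Om)).1.
  have [zt yt] := (zL2 _ _ hz tT, zL2 _ _ hy tT).
  have zst : L2bdry Om ((z + s *: y).1 t) by exact: zL2 hzs tT.
  rewrite (hS _ _ hR zst) (hS _ _ hR zt) (hS _ _ hR yt) zsE.
  exact: (hl s _ _ _ yt zt hR).
have Dee : D e e = s ^+ 2 * L w.
  have Dew : D e w = D w e.
    apply: eq_tint => t tT.
    exact: (hB.1 _ _ (inU _ _ he tT) (inU _ _ hw tT)).
  have [_ d] := dual _ _ hy he.
  by rewrite (De _ he) /L -d; rewrite [tint _ _]Dew (De _ hw) mulrA.
(* Here [us - ud = e + f], so [De] and [Dee] evaluate the mixed and the pure term; the factor 1 fits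
   the pattern [a *: u + v]. *)
have Dus : tint T (fun t => rho_ip Om rho (us t - ud t) (us t - ud t)) =
    1 * D e e + (2 * D f e + D f f).
  have i1 := rint _ _ he he; have i2 := rint _ _ hf he; have i3 := rint _ _ hf hf.
  have i4 := tintegrable_lin 2 i2 i3.
  have q1 := tint_lin 2 i2 i3; have q2 := tint_lin 1 i1 i4.
  apply: (etrans _ (etrans q2 _)); last by congr (_ + _); exact: q1.
  apply: eq_tint => t tT.
  have [et ft] := (inU _ _ he tT, inU _ _ hf tT).
  have -> : us t - ud t = 1 *: e t + f t.
    by rewrite scale1r /e /f addrA subrK.
  rewrite (bil_lin_sqr hL2 hB 1 et ft) (hB.1 _ _ et ft).
  by rewrite expr1n mulr1 addrA.
have hX := L20bdry_lin_closed H1_1 hgam; have hQ := L20bdry_semi_inner Om.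
have [_ z2 _ _ _] := hz; have [_ y2 _ _ _] := hy.
have [z2X _ _] := z2; have [y2X _ _] := y2.
have Nzs : tint T (fun t => L2norm (surf Om) ((z + s *: y).2 t) ^+ 2) =
    s ^+ 2 * N2 y.2 y.2 + (2 * s * N2 z.2 y.2 + N2 z.2 z.2).
  have i1 := bochner_L2_form_integrable hX hQ y2 y2.
  have i2 := bochner_L2_form_integrable hX hQ z2 y2.
  have i3 := bochner_L2_form_integrable hX hQ z2 z2.
  have i4 := tintegrable_lin (2 * s) i2 i3.
  have q1 := tint_lin (2 * s) i2 i3; have q2 := tint_lin (s ^+ 2) i1 i4.
  apply: (etrans _ (etrans q2 _)); last by congr (_ + _); exact: q1.
  apply: eq_tint => t tT; have [zt yt] := (z2X _ tT, y2X _ tT).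
  rewrite zsE (_ : (s *: y + z).2 t = s *: y.2 t + z.2 t)//.
  rewrite [LHS](qnorm_sqr hQ); last exact: hX.2.
  by rewrite (bil_lin_sqr hX hQ.1 s yt zt) (hQ.1.1 _ _ yt zt) addrA.
have Nz : tint T (fun t => L2norm (surf Om) (z.2 t) ^+ 2) = N2 z.2 z.2.
  by apply: eq_tint => t tT; rewrite [LHS](qnorm_sqr hQ)//; exact: z2X.
have jzs : jh Om T rho Sh ud alpha (z + s *: y) =
    2^-1 * (1 * (s ^+ 2 * L w) + (2 * (s * L f) + D f f)) +
    alpha / 2 * (s ^+ 2 * N2 y.2 y.2 + (2 * s * N2 z.2 y.2 + N2 z.2 z.2)).
  rewrite -(De f hf) -Dee; congr (_ * _ + _ * _); [exact: Dus | exact: Nzs].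
have jz : jh Om T rho Sh ud alpha z = 2^-1 * D f f + alpha / 2 * N2 z.2 z.2.
  by congr (_ + _ * _); exact: Nz.
rewrite jzs jz; move: (L w) (L f) (D f f) (N2 _ _) (N2 _ _) (N2 _ _) => x1 x2 x3 x4 x5 x6.
by field.
Unshelve. all: by end_near.
Qed.
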